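(* Let $\mathrm{A}$ be a nontrivial complex $3$-dimensional derived commutative associative algebra. Then $\mathrm{A}$ is isomorphic to one of the metabelian commutative algebras $\mathrm{M}_{01},\mathrm{M}_{02},\mathrm{M}_{03},\mathrm{M}_{04}^{\alpha},\mathrm{M}_{05},\mathrm{M}_{06},\mathrm{M}_{07}$, or to one of the commutative associative algebras $\mathrm{J}_{01},\dots,\mathrm{J}_{11}$ (both lists are given in the context), or it is isomorphic to one of the following commutative algebras with basis $e_1,e_2,e_3$ (where $\alpha,\beta,\gamma\in\mathbb{C}$): - $\mathrm{A}_{01}^{\alpha,\beta,\gamma}$: $e_1e_1=e_1$, $e_2e_2=e_2$, $e_1e_3=\alpha e_2$, $e_2e_3=\beta e_1$, $e_3e_3=e_1+\gamma e_2$; - $\mathrm{A}_{02}^{\alpha}$: $e_1e_1=e_1$, $e_2e_2=e_2$, $e_1e_3=e_2$, $e_2e_3=\alpha e_1$; - $\mathrm{A}_{03}^{\alpha}$: $e_1e_1=e_1$, $e_2e_3=e_2$, $e_3e_3=\alpha e_1$; - $\mathrm{A}_{04}^{\alpha}$: $e_1e_1=e_1$, $e_2e_3=e_1+e_2$, $e_3e_3=\alpha e_1$; - $\mathrm{A}_{05}^{\alpha,\beta}$: $e_1e_1=e_1$, $e_1e_3=e_2$, $e_2e_3=\alpha e_1+e_2$, $e_3e_3=\beta e_1$; - $\mathrm{A}_{06}^{\alpha}$: $e_1e_1=e_1$, $e_1e_3=e_2$, $e_2e_3=e_1$, $e_3e_3=\alpha e_2$; - $\mathrm{A}_{07}$: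 $e_1e_1=e_1$, $e_1e_3=e_2$; - $\mathrm{A}_{08}$: $e_1e_1=e_1$, $e_1e_3=e_2$, $e_3e_3=e_2$; - $\mathrm{A}_{09}^{\alpha}$: $e_1e_1=e_1$, $e_1e_3=e_2$, $e_3e_3=e_1+\alpha e_2$; - $\mathrm{A}_{10}$: $e_1e_1=e_1$, $e_2e_3=e_1$, $e_3e_3=e_2$; - $\mathrm{A}_{11}$: $e_1e_1=e_1$, $e_3e_3=e_1+e_2$; - $\mathrm{A}_{12}^{\alpha,\beta}$: $e_1e_1=e_1$, $e_1e_2=e_2$, $e_1e_3=e_1$, $e_2e_3=\alpha e_1$, $e_3e_3=\beta e_1+e_2$; - $\mathrm{A}_{13}^{\alpha}$: $e_1e_1=e_1$, $e_1e_2=e_2$, $e_1e_3=e_1$, $e_2e_3=e_1$, $e_3e_3=\alpha e_1$; - $\mathrm{A}_{14}^{\alpha}$: $e_1e_1=e_1$, $e_1e_2=e_2$, $e_1e_3=e_1$, $e_3e_3=\alpha e_1$; - $\mathrm{A}_{15}^{\alpha}$: $e_1e_1=e_1$, $e_1e_2=e_2$, $e_2e_3=e_1$, $e_3e_3=e_1+\alpha e_2$; - $\mathrm{A}_{16}$: $e_1e_1=e_1$, $e_1e_2=e_2$, $e_3e_3=e_1+e_2$; - $\mathrm{A}_{17}$: $e_1e_1=e_1$, $e_1e_2=e_2$, $e_3e_3=e_1$; - $\mathrm{A}_{18}$: $e_1e_1=e_1$, $e_1e_2=e_2$, $e_2e_3=e_1$, $e_3e_3=e_2$; - $\mathrm{A}_{19}$: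 $e_1e_1=e_1$, $e_1e_2=e_2$, $e_2e_3=e_1$; - $\mathrm{A}_{20}$: $e_1e_1=e_1$, $e_1e_2=e_2$, $e_3e_3=e_2$; - $\mathrm{A}_{21}^{\alpha}$: $e_1e_1=e_2$, $e_2e_3=e_1+e_2$, $e_3e_3=\alpha e_2$; - $\mathrm{A}_{22}$: $e_1e_1=e_2$, $e_2e_3=e_1$; - $\mathrm{A}_{23}$: $e_1e_1=e_2$, $e_2e_3=e_1$, $e_3e_3=e_2$; - $\mathrm{A}_{24}^{\alpha}$: $e_1e_1=e_2$, $e_1e_3=e_1$, $e_2e_3=\alpha e_2$; - $\mathrm{A}_{25}$: $e_1e_1=e_2$, $e_1e_3=e_1$, $e_3e_3=e_2$; - $\mathrm{A}_{26}$: $e_1e_1=e_2$, $e_1e_3=e_1+e_2$, $e_2e_3=e_2$; - $\mathrm{A}_{27}$: $e_1e_1=e_2$, $e_3e_3=e_1$; - $\mathrm{A}_{28}$: $e_1e_1=e_2$, $e_2e_3=e_2$, $e_3e_3=e_1$; - $\mathrm{A}_{29}$: $e_1e_1=e_1$, $e_2e_3=e_1$; - $\mathrm{A}_{30}$: $e_1e_1=e_1$, $e_3e_3=e_1$. All the algebras $\mathrm{A}_{01}^{\alpha,\beta,\gamma},\dots,\mathrm{A}_{30}$ listed here are pairwise non-isomorphic, except for the following isomorphisms (whenever the inverses occurring are defined): $$\mathrm{A}_{01}^{\alpha,\beta,\gamma}\cong\mathrm{A}_{01}^{-\alpha,\beta,\gamma}\cong\mathrm{A}_{01}^{\alpha,-\beta,\gamma}\cong\mathrm{A}_{01}^{\beta\gamma^{-1/2},\,\alpha\gamma^{-1/2},\,\gamma^{-1}},\quad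 \mathrm{A}_{02}^{\alpha}\cong\mathrm{A}_{02}^{\alpha^{-1}},\quad \mathrm{A}_{06}^{\alpha}\cong\mathrm{A}_{06}^{-\alpha},\quad \mathrm{A}_{09}^{\alpha}\cong\mathrm{A}_{09}^{-\alpha},\quad \mathrm{A}_{15}^{\alpha}\cong\mathrm{A}_{15}^{-\alpha}.$$
   Context: An algebra is a vector space over $\mathbb{C}$ with a bilinear multiplication (not assumed associative). An algebra is nontrivial if its multiplication is nonzero. For an algebra $\mathrm{A}$, $\mathrm{A}^2$ denotes the subspace (subalgebra) spanned by all products $xy$, $x,y\in\mathrm{A}$. A commutative algebra $\mathrm{A}$ is called a derived commutative associative algebra if $\mathrm{A}^2$ is a commutative associative algebra. An algebra is metabelian if it satisfies $(xy)(zt)=0$. In all tables the algebras are commutative with basis $e_1,e_2,e_3$; products of basis elements that are zero or follow from the listed ones by commutativity are omitted. Metabelian commutative algebras ($\alpha\in\mathbb{C}$): $\mathrm{M}_{01}$: $e_1e_1=e_2$; $\mathrm{M}_{02}$: $e_1e_2=e_3$; $\mathrm{M}_{03}$: $e_1e_1=e_2$, $e_1e_2=e_3$; $\mathrm{M}_{04}^{\alpha}$: $e_1e_3=e_1$, $e_2e_3=\alpha e_2$; $\mathrm{M}_{05}$: $e_1e_3=e_1$, $e_3e_3=e_2$; $\mathrm{M}_{06}$: $e_1e_3=e_1+e_2$, $e_2e_3=e_2$; $\mathrm{M}_{07}$: $e_1e_3=e_1$, $e_2e_2=e_1$. Commutative associative algebras: $\mathrm{J}_{01}$: $e_1e_1=e_1$,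 $e_2e_2=e_2$; $\mathrm{J}_{02}$: $e_1e_1=e_1$, $e_1e_2=e_2$; $\mathrm{J}_{03}$: $e_1e_1=e_1$; $\mathrm{J}_{04}$: $e_1e_1=e_2$; $\mathrm{J}_{05}$: $e_1e_2=e_3$; $\mathrm{J}_{06}$: $e_1e_1=e_2$, $e_1e_2=e_3$; $\mathrm{J}_{07}$: $e_1e_1=e_1$, $e_2e_2=e_2$, $e_3e_3=e_3$; $\mathrm{J}_{08}$: $e_1e_1=e_1$, $e_2e_2=e_2$, $e_2e_3=e_3$; $\mathrm{J}_{09}$: $e_1e_1=e_1$, $e_1e_2=e_2$, $e_1e_3=e_3$; $\mathrm{J}_{10}$: $e_1e_1=e_1$, $e_1e_2=e_2$, $e_1e_3=e_3$, $e_2e_2=e_3$; $\mathrm{J}_{11}$: $e_1e_1=e_1$, $e_2e_2=e_3$.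
   Formalization: The isomorphisms of A01 under separate sign changes of α or of β are false (A01^{1,1,0} and A01^{-1,1,0} are not isomorphic); they are replaced by A01^{α,β,γ} ≅ A01^{-α,-β,γ}, with the other listed isomorphisms unchanged. *)

(* Defs.v *)
From HB Require Import structures.
From mathcomp Require Import all_boot all_order all_algebra.
From mathcomp Require Import complex reals ring.
From Stdlib Require Relation_Operators.

Set Implicit Arguments.
Unset Strict Implicit.
Unset Printing Implicit Defensive.

Import GRing.Theory.
Local Open Scope ring_scope.

Record algebra (K : fieldType) := MkAlgebra {
  alg_space :> vectType K;
  alg_mul : {bilinear alg_space -> alg_space -> alg_space}
}.

Notation "x ** y" := (alg_mul _ x y) (at level 40, left associativity)
  : ring_scope.

Section AlgebraNotions.
Variables (K : fieldType) (A : algebra K).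

Definition nontrivial := exists x y : A, x ** y != 0.

(* v lies in A^2: a linear combination of products involves only finitely many
   of them, namely the products of the pairs listed in s. *)
Definition in_square (v : A) :=
  exists s : seq (A * A), v \in <<[seq p.1 ** p.2 | p <- s]>>%VS.

Definition square_comm_assoc :=
  (forall x y : A, in_square x -> in_square y -> x ** y = y ** x) /\
  (forall x y z : A, in_square x -> in_square y -> in_square z ->
     (x ** y) ** z = x ** (y ** z)).

Definition derived_comm_assoc :=
  (forall x y : A, x ** y = y ** x) /\ square_comm_assoc.

End AlgebraNotions.

Definition alg_isomorphic (K : fieldType) (A B : algebra K) :=
  exists f : {linear A -> B},
    bijective f /\ forall x y : A, f (x ** y) = f x ** f y.

Section TableAlgebra.
Variables (K : fieldType) (p11 p12 p13 p22 p23 p33 : 'rV[K]_3).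

(* The commutative multiplication on K^3 with e_i e_j = pij for i <= j.
   Matrix indices start at 0, so e_i has its 1 in column i - 1. *)
Definition table_mul (x y : 'rV[K]_3) : 'rV[K]_3 :=
  let x1 := x 0 0 in let x2 := x 0 1 in let x3 := x 0 2%:R in
  let y1 := y 0 0 in let y2 := y 0 1 in let y3 := y 0 2%:R in
  (x1 * y1) *: p11 + (x1 * y2 + x2 * y1) *: p12
  + (x1 * y3 + x3 * y1) *: p13 + (x2 * y2) *: p22
  + (x2 * y3 + x3 * y2) *: p23 + (x3 * y3) *: p33.

Fact table_mul_bilinear : bilinear_for *:%R *:%R table_mul.
Proof.
by split=> u c x y; rewrite /table_mul; apply/rowP=> i; rewrite !mxE; ring.
Qed.

HB.instance Definition _ :=
  bilinear_isBilinear.Build K 'rV[K]_3 'rV[K]_3 'rV[K]_3 *:%R *:%R table_mul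
    table_mul_bilinear.

Definition table : algebra K := MkAlgebra table_mul.

End TableAlgebra.

Inductive M_label (K : Type) :=
  | M01 | M02 | M03 | M04 of K | M05 | M06 | M07.

Inductive J_label :=
  | J01 | J02 | J03 | J04 | J05 | J06 | J07 | J08 | J09 | J10 | J11.

Inductive A_label (K : Type) :=
  | A01 of K & K & K | A02 of K | A03 of K | A04 of K | A05 of K & K
  | A06 of K | A07 | A08 | A09 of K | A10 | A11 | A12 of K & K | A13 of K
  | A14 of K | A15 of K | A16 | A17 | A18 | A19 | A20 | A21 of K | A22 | A23
  | A24 of K | A25 | A26 | A27 | A28 | A29 | A30.

Section Lists.
Variable K : fieldType.

Let e1 : 'rV[K]_3 := delta_mx 0 0.
Let e2 : 'rV[K]_3 := delta_mx 0 1.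
Let e3 : 'rV[K]_3 := delta_mx 0 2%:R.

Definition M_algebra (l : M_label K) : algebra K :=
  match l with
  (*                     e1e1   e1e2   e1e3      e2e2   e2e3      e3e3   *)
  | M01       => table   e2     0      0         0      0         0
  | M02       => table   0      e3     0         0      0         0
  | M03       => table   e2     e3     0         0      0         0
  | M04 a     => table   0      0      e1        0      (a *: e2) 0
  | M05       => table   0      0      e1        0      0         e2
  | M06       => table   0      0      (e1 + e2) 0      e2        0
  | M07       => table   0      0      e1        e1     0         0
  end.

Definition J_algebra (l : J_label) : algebra K :=
  match l with
  (*                     e1e1   e1e2   e1e3      e2e2   e2e3      e3e3   *)
  | J01       => table   e1     0      0         e2     0         0
  | J02       => table   e1     e2     0         0      0         0
  | J03       => table   e1     0      0         0      0         0
  | J04       => table   e2     0      0         0      0         0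
  | J05       => table   0      e3     0         0      0         0
  | J06       => table   e2     e3     0         0      0         0
  | J07       => table   e1     0      0         e2     0         e3
  | J08       => table   e1     0      0         e2     e3        0
  | J09       => table   e1     e2     e3        0      0         0
  | J10       => table   e1     e2     e3        e3     0         0
  | J11       => table   e1     0      0         e3     0         0
  end.

Definition A_algebra (l : A_label K) : algebra K :=
  match l with
  (*                     e1e1   e1e2   e1e3      e2e2   e2e3           e3e3 *)
  | A01 a b c => table   e1     0      (a *: e2) e2     (b *: e1)      (e1 + c *: e2)
  | A02 a     => table   e1     0      e2        e2     (a *: e1)      0
  | A03 a     => table   e1     0      0         0      e2             (a *: e1)
  | A04 a     => table   e1     0      0         0      (e1 + e2)      (a *: e1)
  | A05 a b   => table   e1     0      e2        0      (a *: e1 + e2) (b *: e1)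
  | A06 a     => table   e1     0      e2        0      e1             (a *: e2)
  | A07       => table   e1     0      e2        0      0              0
  | A08       => table   e1     0      e2        0      0              e2
  | A09 a     => table   e1     0      e2        0      0              (e1 + a *: e2)
  | A10       => table   e1     0      0         0      e1             e2
  | A11       => table   e1     0      0         0      0              (e1 + e2)
  | A12 a b   => table   e1     e2     e1        0      (a *: e1)      (b *: e1 + e2)
  | A13 a     => table   e1     e2     e1        0      e1             (a *: e1)
  | A14 a     => table   e1     e2     e1        0      0              (a *: e1)
  | A15 a     => table   e1     e2     0         0      e1             (e1 + a *: e2)
  | A16       => table   e1     e2     0         0      0              (e1 + e2)
  | A17       => table   e1     e2     0         0      0              e1
  | A18       => table   e1     e2     0         0      e1             e2
  | A19       => table   e1     e2     0         0      e1             0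
  | A20       => table   e1     e2     0         0      0              e2
  | A21 a     => table   e2     0      0         0      (e1 + e2)      (a *: e2)
  | A22       => table   e2     0      0         0      e1             0
  | A23       => table   e2     0      0         0      e1             e2
  | A24 a     => table   e2     0      e1        0      (a *: e2)      0
  | A25       => table   e2     0      e1        0      0              e2
  | A26       => table   e2     0      (e1 + e2) 0      e2             0
  | A27       => table   e2     0      0         0      0              e1
  | A28       => table   e2     0      0         0      e2             e1
  | A29       => table   e1     0      0         0      e1             0
  | A30       => table   e1     0      0         0      0              e1
  end.

End Lists.

(* The exceptional isomorphisms among the algebras of the A list.  Independent
   sign changes of a and b do not give isomorphic algebras in general: an
   isomorphism fixing e1 and e2 sends e3 to e3 or -e3, hence changes both signs
   at once; for instance A01 1 1 0 and A01 (-1) 1 0 are not isomorphic.  In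
   A01_swap, s is either square root of c. *)
Inductive exceptional (K : fieldType) : A_label K -> A_label K -> Prop :=
  | A01_sign a b c : exceptional (A01 a b c) (A01 (- a) (- b) c)
  | A01_swap a b c s : c != 0 -> s ^+ 2 = c ->
      exceptional (A01 a b c) (A01 (b / s) (a / s) c^-1)
  | A02_inv a : a != 0 -> exceptional (A02 a) (A02 a^-1)
  | A06_sign a : exceptional (A06 a) (A06 (- a))
  | A09_sign a : exceptional (A09 a) (A09 (- a))
  | A15_sign a : exceptional (A15 a) (A15 (- a)).

Definition same_class (K : fieldType) : A_label K -> A_label K -> Prop :=
  Relation_Operators.clos_refl_sym_trans (A_label K) (@exceptional K).

(* Main.v *)
Require Import Defs.
From HB Require Import structures.
From mathcomp Require Import all_boot all_order all_algebra.
From mathcomp Require Import complex reals boolp ring.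
From Stdlib Require Nsatz.
Set Implicit Arguments.
Unset Strict Implicit.
Unset Printing Implicit Defensive.
Import GRing.Theory Num.Theory.
Local Open Scope ring_scope.

                                                                               
                                                                                 
                                                                              
                                                                        
                                                                          
                                                                   
                                                                     
                                                                          
                                                                               
                                                                               
                                            
                                                                         
                                                                            
                                                                               
                          

                    

(** Everything is governed by the square A^2, which has dimension 1, 2 or 3 and is commutative
    associative.

    If A^2 is spanned by one vector v, then xy = f(x, y) v for a symmetric bilinear form f. The
    normal form depends on the position of v (anisotropic, isotropic outside the radical of f, or in
    the radical) and on the rank of a binary form ([ltab_listed]).

    If A^2 is a plane, complete a basis e1, e2 of it by some e3. Over an algebraically closed field
    the plane is C x C, the dual numbers, C plus a null line, the span of g and g^2 with g^3 = 0, or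
    it has zero product ([block_listed]). What remains is e1e3, e2e3, e3e3, taken up to
    automorphisms of the plane and replacements of e3 by k e3 plus an element of the plane. Each
    type has its own reduction: [split_listed], [local_listed], [half_listed], [nil_listed],
    [null_listed].

    If A^2 = A, then A is associative and has a unit ([unit_exists]). Either it is generated by one
    element, hence is C[X] modulo a cubic, or it is the unit plus a plane with zero product
    ([unital_listed]).

    For the isomorphism problem, an isomorphism carries A^2 onto A^2, so between algebras whose
    square is the plane of e1, e2 it is block triangular ([block_coords]). The type of the plane is
    an invariant ([ttab_inj]). Inside a type few block matrices survive, and comparing structure
    constants leaves only equal parameters or the exceptional pairs ([iso_same_class]). Explicit
    base changes realise the exceptional pairs ([exceptional_iso]). *)

Section Isomorphism.
Variable K : fieldType.
Implicit Types A B C : algebra K.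

Lemma alg_iso_refl A : alg_isomorphic A A.
Proof. by exists idfun; split=> //; exists id. Qed.

Lemma alg_iso_sym A B : alg_isomorphic A B -> alg_isomorphic B A.
Proof.
case=> f [[g fK gK] fM].
have gl : linear g by move=> k x y; apply: (can_inj fK); rewrite gK linearP !gK.
pose gL : {linear B -> A} := HB.pack g (GRing.isLinear.Build K B A *:%R g gl).
exists gL; split; first by exists f.
by move=> x y /=; apply: (can_inj fK); rewrite fM !gK.
Qed.

Lemma alg_iso_trans A B C :
  alg_isomorphic A B -> alg_isomorphic B C -> alg_isomorphic A C.
Proof.
case=> f [bf fM] [g [bg gM]]; exists (g \o f); split; first exact: bij_comp.
by move=> x y /=; rewrite fM gM.
Qed.

Lemma nontrivial_iso A B : alg_isomorphic A B -> nontrivial A -> nontrivial B.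
Proof.
case=> f [bf fM] [x [y xy]]; exists (f x), (f y).
by rewrite -fM -(linear0 f) (inj_eq (bij_inj bf)).
Qed.

End Isomorphism.

(** * Coordinates, bases and structure tables *)

Section Coordinates.
Variable K : fieldType.
Implicit Types (A : algebra K) (v : 'rV[K]_3).

Definition vec (a b c : K) : 'rV[K]_3 :=
  \row_i (if i == 0 then a else if i == 1 then b else c).

Lemma vec_eta v : v = vec (v 0 0) (v 0 1) (v 0 2%:R).
Proof.
apply/rowP => i; rewrite mxE.
case: i => -[|[|[|i]]] Hi //=; congr (v _ _); exact/val_inj.
Qed.

Lemma vec_inj a b c a' b' c' :
  vec a b c = vec a' b' c' -> [/\ a = a', b = b' & c = c'].
Proof.
move=> /rowP E; split.
- by have := E 0; rewrite !mxE.
- by have := E 1; rewrite !mxE.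
- by have := E 2%:R; rewrite !mxE.
Qed.

Lemma vecD a b c a' b' c' :
  vec a b c + vec a' b' c' = vec (a + a') (b + b') (c + c').
Proof. by rewrite [LHS]vec_eta !mxE. Qed.

Lemma vecZ k a b c : k *: vec a b c = vec (k * a) (k * b) (k * c).
Proof. by rewrite [LHS]vec_eta !mxE. Qed.

Lemma vec0 : 0 = vec 0 0 0.
Proof. by rewrite [LHS]vec_eta !mxE. Qed.

Lemma vec1 : delta_mx 0 0 = vec 1 0 0.
Proof. by rewrite [LHS]vec_eta !mxE. Qed.

Lemma vec2 : delta_mx 0 1 = vec 0 1 0.
Proof. by rewrite [LHS]vec_eta !mxE. Qed.

Lemma vec3 : delta_mx 0 2%:R = vec 0 0 1.
Proof. by rewrite [LHS]vec_eta !mxE. Qed.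

Definition vecE := (vec1, vec2, vec3, vecZ, vecD).

Lemma vec_coord a b c :
  (vec a b c 0 0 = a) * (vec a b c 0 1 = b) * (vec a b c 0 2%:R = c).
Proof. by rewrite !mxE. Qed.

Definition det3 (x1 x2 x3 y1 y2 y3 z1 z2 z3 : K) :=
  x1 * (y2 * z3 - y3 * z2) - x2 * (y1 * z3 - y3 * z1)
  + x3 * (y1 * z2 - y2 * z1).

Lemma det3_free x1 x2 x3 y1 y2 y3 z1 z2 z3 :
  det3 x1 x2 x3 y1 y2 y3 z1 z2 z3 != 0 ->
  free [:: vec x1 x2 x3; vec y1 y2 y3; vec z1 z2 z3].
Proof.
move=> D; apply/freeP => k; rewrite !big_ord_recl big_ord0 addr0 /= !vecE vec0.
case/vec_inj.
set a := k _; set b := k _; set c := k _ => e1 e2 e3.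
(* Cramer's rule: combining the three equations with cofactors isolates one coefficient times the
   determinant. *)
have aD : a * det3 x1 x2 x3 y1 y2 y3 z1 z2 z3 = 0.
  transitivity ((a * x1 + (b * y1 + c * z1)) * (y2 * z3 - y3 * z2)
   - (a * x2 + (b * y2 + c * z2)) * (y1 * z3 - y3 * z1)
   + (a * x3 + (b * y3 + c * z3)) * (y1 * z2 - y2 * z1)).
    by rewrite /det3; ring.
  by rewrite e1 e2 e3; ring.
have bD : b * det3 x1 x2 x3 y1 y2 y3 z1 z2 z3 = 0.
  transitivity (- (a * x1 + (b * y1 + c * z1)) * (x2 * z3 - x3 * z2)
   + (a * x2 + (b * y2 + c * z2)) * (x1 * z3 - x3 * z1)
   - (a * x3 + (b * y3 + c * z3)) * (x1 * z2 - x2 * z1)).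
    by rewrite /det3; ring.
  by rewrite e1 e2 e3; ring.
have cD : c * det3 x1 x2 x3 y1 y2 y3 z1 z2 z3 = 0.
  transitivity ((a * x1 + (b * y1 + c * z1)) * (x2 * y3 - x3 * y2)
   - (a * x2 + (b * y2 + c * z2)) * (x1 * y3 - x3 * y1)
   + (a * x3 + (b * y3 + c * z3)) * (x1 * y2 - x2 * y1)).
    by rewrite /det3; ring.
  by rewrite e1 e2 e3; ring.
move: aD bD cD => /eqP; rewrite mulf_eq0 (negbTE D) orbF => /eqP a0 /eqP.
rewrite mulf_eq0 (negbTE D) orbF => /eqP b0 /eqP.
rewrite mulf_eq0 (negbTE D) orbF => /eqP c0.
case=> -[|[|[|i]]] Hi //.
- by rewrite -[RHS]a0; congr (k _); apply/val_inj.
- by rewrite -[RHS]b0; congr (k _); apply/val_inj.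
- by rewrite -[RHS]c0; congr (k _); apply/val_inj.
Qed.

Lemma table_mul_vec a1 a2 a3 b1 b2 b3 c1 c2 c3 d1 d2 d3 f1 f2 f3 g1 g2 g3
    x1 x2 x3 y1 y2 y3 :
  table_mul (vec a1 a2 a3) (vec b1 b2 b3) (vec c1 c2 c3)
    (vec d1 d2 d3) (vec f1 f2 f3) (vec g1 g2 g3)
    (vec x1 x2 x3) (vec y1 y2 y3) =
  let m (a b c d f g : K) :=
    x1 * y1 * a + (x1 * y2 + x2 * y1) * b + (x1 * y3 + x3 * y1) * c
    + x2 * y2 * d + (x2 * y3 + x3 * y2) * f + x3 * y3 * g in
  vec (m a1 b1 c1 d1 f1 g1) (m a2 b2 c2 d2 f2 g2) (m a3 b3 c3 d3 f3 g3).
Proof. by rewrite [LHS]vec_eta /table_mul !mxE. Qed.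

Definition comb A (v1 v2 v3 : A) (c : 'rV[K]_3) : A :=
  c 0 0 *: v1 + c 0 1 *: v2 + c 0 2%:R *: v3.

Lemma amulDl A (x y z : A) : (x + y) ** z = x ** z + y ** z.
Proof. exact: linearDl. Qed.
Lemma amulDr A (x y z : A) : z ** (x + y) = z ** x + z ** y.
Proof. exact: linearDr. Qed.
Lemma amulZl A k (x y : A) : (k *: x) ** y = k *: (x ** y).
Proof. exact: linearZl_LR. Qed.
Lemma amulZr A k (x y : A) : x ** (k *: y) = k *: (x ** y).
Proof. exact: linearZr. Qed.

End Coordinates.

Section TableIsomorphism.
Variable K : fieldType.
Implicit Types A : algebra K.

Lemma comb_linear A (v1 v2 v3 : A) : linear (comb v1 v2 v3).
Proof.
move=> k x y; rewrite /comb !mxE !scalerDr !scalerDl !scalerA.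
by rewrite (addrACA (_ *: v1) _ (_ *: v2)) [LHS]addrACA.
Qed.

HB.instance Definition _ A (v1 v2 v3 : A) :=
  GRing.isLinear.Build K 'rV[K]_3 A *:%R (comb v1 v2 v3)
    (comb_linear v1 v2 v3).

Lemma combD A (v1 v2 v3 : A) x y :
  comb v1 v2 v3 (x + y) = comb v1 v2 v3 x + comb v1 v2 v3 y.
Proof. exact: linearD. Qed.

Lemma combZ A (v1 v2 v3 : A) k x :
  comb v1 v2 v3 (k *: x) = k *: comb v1 v2 v3 x.
Proof. exact: linearZ. Qed.

Lemma comb_mul A (v1 v2 v3 : A) p11 p12 p13 p22 p23 p33 :
  (forall x y : A, x ** y = y ** x) ->
  v1 ** v1 = comb v1 v2 v3 p11 -> v1 ** v2 = comb v1 v2 v3 p12 ->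
  v1 ** v3 = comb v1 v2 v3 p13 -> v2 ** v2 = comb v1 v2 v3 p22 ->
  v2 ** v3 = comb v1 v2 v3 p23 -> v3 ** v3 = comb v1 v2 v3 p33 ->
  forall x y : table p11 p12 p13 p22 p23 p33, comb v1 v2 v3 (x ** y)
    = comb v1 v2 v3 x ** comb v1 v2 v3 y.
Proof.
move=> AC e11 e12 e13 e22 e23 e33 x y.
set T := table _ _ _ _ _ _ in x y *.
pose u1 : T := vec 1 0 0; pose u2 : T := vec 0 1 0; pose u3 : T := vec 0 0 1.
have uE (z : T) : z = z 0 0 *: u1 + z 0 1 *: u2 + z 0 2%:R *: u3.
  by rewrite {1}[z]vec_eta !vecE; congr vec; ring.
have uM (a1 a2 a3 b1 b2 b3 : K) :
    (vec a1 a2 a3 : T) ** (vec b1 b2 b3 : T) =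
    (a1 * b1) *: p11 + (a1 * b2 + a2 * b1) *: p12
    + (a1 * b3 + a3 * b1) *: p13 + (a2 * b2) *: p22
    + (a2 * b3 + a3 * b2) *: p23 + (a3 * b3) *: p33.
  by rewrite /= /table_mul !vec_coord.
rewrite {1}[x]uE {1}[y]uE {2 3}/comb !(amulDl, amulDr, amulZl, amulZr).
rewrite !uM !(mulr0, mul0r, addr0, add0r, mulr1, scale0r, scale1r).
rewrite !(combD, combZ) -e11 -e12 -e13 -e22 -e23 -e33.
by rewrite (AC v2 v1) (AC v3 v1) (AC v3 v2).
Qed.

(** Reading off structure constants in a basis identifies an abstract algebra with a table; all
    later work is on tables. *)
Lemma iso_of_basis A (v1 v2 v3 : A) p11 p12 p13 p22 p23 p33 :
  \dim (fullv : {vspace A}) = 3%N ->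
  (forall x y : A, x ** y = y ** x) ->
  free [:: v1; v2; v3] ->
  v1 ** v1 = comb v1 v2 v3 p11 -> v1 ** v2 = comb v1 v2 v3 p12 ->
  v1 ** v3 = comb v1 v2 v3 p13 -> v2 ** v2 = comb v1 v2 v3 p22 ->
  v2 ** v3 = comb v1 v2 v3 p23 -> v3 ** v3 = comb v1 v2 v3 p33 ->
  alg_isomorphic A (table p11 p12 p13 p22 p23 p33).
Proof.
move=> dimA AC vfree e11 e12 e13 e22 e23 e33; apply: alg_iso_sym.
pose T := table p11 p12 p13 p22 p23 p33.
pose X := [tuple v1; v2; v3].
exists (comb v1 v2 v3 : {linear T -> A}); split; last exact: comb_mul.
have X_basis : basis_of fullv X by rewrite basisEfree vfree subvf dimA.
have combE (r : 'rV[K]_3) : comb v1 v2 v3 r = \sum_i r 0 i *: X`_i.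
  rewrite !big_ord_recl big_ord0 addr0 /= /comb -addrA.
  by do !congr (_ + _); congr (_ *: _); congr (r _ _); apply/val_inj.
exists (fun a => \row_i coord X i a) => [r|a].
  by apply/rowP => i; rewrite mxE /= combE coord_sum_free.
rewrite /= combE [RHS](coord_basis X_basis) ?memvf //.
by apply: eq_bigr => i _; rewrite mxE.
Qed.

Lemma dim_row3 : \dim (fullv : {vspace 'rV[K]_3}) = 3%N.
Proof. by rewrite dimvf /dim /=. Qed.

Lemma table_mulC p11 p12 p13 p22 p23 p33 :
  forall x y : table (K := K) p11 p12 p13 p22 p23 p33, x ** y = y ** x.
Proof. by move=> x y /=; rewrite /table_mul; apply/rowP => i; rewrite !mxE; ring. Qed.

Lemma det3_mul (a1 a2 a3 b1 b2 b3 c1 c2 c3 x1 x2 x3 y1 y2 y3 z1 z2 z3 : K) :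
  det3 a1 a2 a3 b1 b2 b3 c1 c2 c3 * det3 x1 x2 x3 y1 y2 y3 z1 z2 z3 =
  det3 (a1 * x1 + a2 * y1 + a3 * z1) (a1 * x2 + a2 * y2 + a3 * z2)
       (a1 * x3 + a2 * y3 + a3 * z3)
       (b1 * x1 + b2 * y1 + b3 * z1) (b1 * x2 + b2 * y2 + b3 * z2)
       (b1 * x3 + b2 * y3 + b3 * z3)
       (c1 * x1 + c2 * y1 + c3 * z1) (c1 * x2 + c2 * y2 + c3 * z2)
       (c1 * x3 + c2 * y3 + c3 * z3).
Proof. by rewrite /det3; ring. Qed.

(** X, Y, Z are the images of e1, e2, e3. An isomorphism thus becomes a system of polynomial
    equations with an invertible determinant. *)
Lemma iso_table_coords p11 p12 p13 p22 p23 p33 q11 q12 q13 q22 q23 q33 :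
  let Q := table q11 q12 q13 q22 q23 q33 in
  alg_isomorphic (table (K := K) p11 p12 p13 p22 p23 p33) Q ->
  exists x1 x2 x3 y1 y2 y3 z1 z2 z3,
    let X : Q := vec x1 x2 x3 in let Y : Q := vec y1 y2 y3 in
    let Z : Q := vec z1 z2 z3 in
    [/\ det3 x1 x2 x3 y1 y2 y3 z1 z2 z3 != 0,
        X ** X = comb X Y Z p11, X ** Y = comb X Y Z p12 &
        [/\ X ** Z = comb X Y Z p13,
        Y ** Y = comb X Y Z p22, Y ** Z = comb X Y Z p23 &
        Z ** Z = comb X Y Z p33]].
Proof.
move=> Q [f [[g fK gK] fM]]; set P := table p11 p12 p13 p22 p23 p33 in f fK gK fM.
have fE (w : P) : f w = comb (f (vec 1 0 0)) (f (vec 0 1 0)) (f (vec 0 0 1)) w.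
  rewrite /comb -!linearZ -!linearD /=; congr (f _).
  by rewrite [LHS]vec_eta !vecE; congr vec; ring.
have pM (a1 a2 a3 b1 b2 b3 : K) :
    (vec a1 a2 a3 : P) ** (vec b1 b2 b3 : P) =
    (a1 * b1) *: p11 + (a1 * b2 + a2 * b1) *: p12
    + (a1 * b3 + a3 * b1) *: p13 + (a2 * b2) *: p22
    + (a2 * b3 + a3 * b2) *: p23 + (a3 * b3) *: p33.
  by rewrite /= /table_mul !vec_coord.
have := vec_eta (f (vec 1 0 0)); have := vec_eta (f (vec 0 1 0)).
have := vec_eta (f (vec 0 0 1)).
set z1 := f _ _ _; set z2 := f _ _ 1; set z3 := f _ _ 2%:R => eZ.
set y1 := f _ _ _; set y2 := f _ _ 1; set y3 := f _ _ 2%:R => eY.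
set x1 := f _ _ _; set x2 := f _ _ 1; set x3 := f _ _ 2%:R => eX.
exists x1, x2, x3, y1, y2, y3, z1, z2, z3.
cbv zeta; rewrite -eX -eY -eZ.
have fprod (r u v : P) : u ** v = r ->
    f u ** f v = comb (f (vec 1 0 0)) (f (vec 0 1 0)) (f (vec 0 0 1)) r.
  by move=> <-; rewrite -fM; exact: fE.
have simp := (mulr0, mul0r, addr0, add0r, mulr1, scale0r, scale1r).
have p_11 : (vec 1 0 0 : P) ** vec 1 0 0 = p11 by rewrite pM !simp.
have p_12 : (vec 1 0 0 : P) ** vec 0 1 0 = p12 by rewrite pM !simp.
have p_13 : (vec 1 0 0 : P) ** vec 0 0 1 = p13 by rewrite pM !simp.
have p_22 : (vec 0 1 0 : P) ** vec 0 1 0 = p22 by rewrite pM !simp.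
have p_23 : (vec 0 1 0 : P) ** vec 0 0 1 = p23 by rewrite pM !simp.
have p_33 : (vec 0 0 1 : P) ** vec 0 0 1 = p33 by rewrite pM !simp.
split; first last.
- by split; apply: fprod.
- exact: fprod.
- exact: fprod.
clear fprod p_11 p_12 p_13 p_22 p_23 p_33 pM fM.
have := gK (vec 1 0 0); have := gK (vec 0 1 0); have := gK (vec 0 0 1).
rewrite (fE (g _)) (fE (g (vec 0 1 0))) (fE (g (vec 1 0 0))).
rewrite eX eY eZ /comb !vecE.
move: (g _) (g _) (g _) => w1 w2 w3.
move=> /vec_inj[e31 e32 e33] /vec_inj[e21 e22 e23] /vec_inj[e11 e12 e13].
apply/eqP => D0.
(* The rows [w1], [w2], [w3] are the preimages of the basis vectors, so their matrix times that of
   X, Y, Z is the identity and no determinant can vanish. *)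
have := det3_mul (w1 0 0) (w1 0 1) (w1 0 2%:R) (w2 0 0) (w2 0 1) (w2 0 2%:R)
  (w3 0 0) (w3 0 1) (w3 0 2%:R) x1 x2 x3 y1 y2 y3 z1 z2 z3.
rewrite D0 mulr0 e11 e12 e13 e21 e22 e23 e31 e32 e33 /det3 => /eqP.
by rewrite !(simp, oppr0) eq_sym oner_eq0.
Qed.

Lemma iso_tables p11 p12 p13 p22 p23 p33 q11 q12 q13 q22 q23 q33
    x1 x2 x3 y1 y2 y3 z1 z2 z3 :
  let P : algebra K := table p11 p12 p13 p22 p23 p33 in
  let X : P := vec x1 x2 x3 in let Y : P := vec y1 y2 y3 in
  let Z : P := vec z1 z2 z3 in
  det3 x1 x2 x3 y1 y2 y3 z1 z2 z3 != 0 ->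
  X ** X = comb X Y Z q11 -> X ** Y = comb X Y Z q12 ->
  X ** Z = comb X Y Z q13 -> Y ** Y = comb X Y Z q22 ->
  Y ** Z = comb X Y Z q23 -> Z ** Z = comb X Y Z q33 ->
  alg_isomorphic P (table q11 q12 q13 q22 q23 q33).
Proof.
move=> P X Y Z D; apply: iso_of_basis; first exact: dim_row3.
  exact: table_mulC.
exact: det3_free.
Qed.

End TableIsomorphism.

(** * Algebras whose square lies in the plane of e1 and e2 *)

Section BlockTables.
Variable K : fieldType.

                                                                               
                                                                             
                      
(** The first three pairs are e1e1, e1e2, e2e2, the product on the plane itself; then come e1e3,
    e2e3, e3e3. This is not the argument order of [table]. *)
Definition btab (b1 b2 c1 c2 d1 d2 a1 a2 p1 p2 w1 w2 : K) : algebra K :=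
  table (vec b1 b2 0) (vec c1 c2 0) (vec a1 a2 0) (vec d1 d2 0)
    (vec p1 p2 0) (vec w1 w2 0).

Definition bprod (b c d : K) (x1 x2 y1 y2 : K) :=
  x1 * y1 * b + (x1 * y2 + x2 * y1) * c + x2 * y2 * d.

                                                                 
                                                                              
                 
(** The new basis is X = (x1, x2, 0), Y = (y1, y2, 0), Z = (z1, z2, k). The equations compare both
    plane coordinates of its six products with the primed structure constants. *)
Definition block_change (b1 b2 c1 c2 d1 d2 a1 a2 p1 p2 w1 w2
    b1' b2' c1' c2' d1' d2' a1' a2' p1' p2' w1' w2'
    x1 x2 y1 y2 z1 z2 k : K) : Prop :=
  (x1 * y2 - x2 * y1 != 0 /\ k != 0) /\
  [/\ bprod b1 c1 d1 x1 x2 x1 x2 = b1' * x1 + b2' * y1,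
      bprod b2 c2 d2 x1 x2 x1 x2 = b1' * x2 + b2' * y2,
      bprod b1 c1 d1 x1 x2 y1 y2 = c1' * x1 + c2' * y1 &
      bprod b2 c2 d2 x1 x2 y1 y2 = c1' * x2 + c2' * y2] /\
  [/\ bprod b1 c1 d1 y1 y2 y1 y2 = d1' * x1 + d2' * y1,
      bprod b2 c2 d2 y1 y2 y1 y2 = d1' * x2 + d2' * y2,
      bprod b1 c1 d1 x1 x2 z1 z2 + k * (x1 * a1 + x2 * p1)
        = a1' * x1 + a2' * y1 &
      bprod b2 c2 d2 x1 x2 z1 z2 + k * (x1 * a2 + x2 * p2)
        = a1' * x2 + a2' * y2] /\
  [/\ bprod b1 c1 d1 y1 y2 z1 z2 + k * (y1 * a1 + y2 * p1)
        = p1' * x1 + p2' * y1,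
      bprod b2 c2 d2 y1 y2 z1 z2 + k * (y1 * a2 + y2 * p2)
        = p1' * x2 + p2' * y2,
      bprod b1 c1 d1 z1 z2 z1 z2 + 2%:R * k * (z1 * a1 + z2 * p1) + k * k * w1
        = w1' * x1 + w2' * y1 &
      bprod b2 c2 d2 z1 z2 z1 z2 + 2%:R * k * (z1 * a2 + z2 * p2) + k * k * w2
        = w1' * x2 + w2' * y2].

Lemma block_iso b1 b2 c1 c2 d1 d2 a1 a2 p1 p2 w1 w2
    b1' b2' c1' c2' d1' d2' a1' a2' p1' p2' w1' w2' x1 x2 y1 y2 z1 z2 k :
  block_change b1 b2 c1 c2 d1 d2 a1 a2 p1 p2 w1 w2
    b1' b2' c1' c2' d1' d2' a1' a2' p1' p2' w1' w2' x1 x2 y1 y2 z1 z2 k ->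
  alg_isomorphic (btab b1 b2 c1 c2 d1 d2 a1 a2 p1 p2 w1 w2)
    (btab b1' b2' c1' c2' d1' d2' a1' a2' p1' p2' w1' w2').
Proof.
case=> -[D k0] [] [E1 E2 E3 E4] [] [E5 E6 E7 E8] [E9 E10 E11 E12].
apply: (@iso_tables K _ _ _ _ _ _ _ _ _ _ _ _ x1 x2 0 y1 y2 0 z1 z2 k).
- have -> : det3 x1 x2 0 y1 y2 0 z1 z2 k = (x1 * y2 - x2 * y1) * k.
    by rewrite /det3; ring.
  by rewrite mulf_neq0.
all: rewrite /= table_mul_vec /comb !vecE !vec_coord; congr vec; last by ring.
- by rewrite mul0r addr0 -E1 /bprod; ring.
- by rewrite mul0r addr0 -E2 /bprod; ring.
- by rewrite mul0r addr0 -E3 /bprod; ring.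
- by rewrite mul0r addr0 -E4 /bprod; ring.
- by rewrite mul0r addr0 -E7 /bprod; ring.
- by rewrite mul0r addr0 -E8 /bprod; ring.
- by rewrite mul0r addr0 -E5 /bprod; ring.
- by rewrite mul0r addr0 -E6 /bprod; ring.
- by rewrite mul0r addr0 -E9 /bprod; ring.
- by rewrite mul0r addr0 -E10 /bprod; ring.
- by rewrite mul0r addr0 -E11 /bprod; ring.
- by rewrite mul0r addr0 -E12 /bprod; ring.
Qed.

                                                                          
                                     
(** Dual form of the statement that the products fill the plane: no nonzero linear functional (s, t)
    kills them all. *)
Definition block_full (b1 b2 c1 c2 d1 d2 a1 a2 p1 p2 w1 w2 : K) : Prop :=
  forall s t, b1 * s + b2 * t = 0 -> c1 * s + c2 * t = 0 ->
    d1 * s + d2 * t = 0 -> a1 * s + a2 * t = 0 -> p1 * s + p2 * t = 0 ->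
    w1 * s + w2 * t = 0 -> s = 0 /\ t = 0.

(** Products in the target have third coordinate 0, so (x3, y3) is a functional killing all products
    of the source. Fullness makes it zero, which is the block triangular shape. *)
Lemma block_coords b1 b2 c1 c2 d1 d2 a1 a2 p1 p2 w1 w2
    b1' b2' c1' c2' d1' d2' a1' a2' p1' p2' w1' w2' :
  block_full b1' b2' c1' c2' d1' d2' a1' a2' p1' p2' w1' w2' ->
  alg_isomorphic (btab b1' b2' c1' c2' d1' d2' a1' a2' p1' p2' w1' w2')
    (btab b1 b2 c1 c2 d1 d2 a1 a2 p1 p2 w1 w2) ->
  exists x1 x2 y1 y2 z1 z2 k,
  block_change b1 b2 c1 c2 d1 d2 a1 a2 p1 p2 w1 w2
    b1' b2' c1' c2' d1' d2' a1' a2' p1' p2' w1' w2' x1 x2 y1 y2 z1 z2 k.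
Proof.
move=> full /iso_table_coords[x1 [x2 [x3 [y1 [y2 [y3 [z1 [z2 [k]]]]]]]]] /=.
rewrite !table_mul_vec /comb !vecE !vec_coord => -[D].
rewrite !(mulr0, addr0, mul0r).
move=> /vec_inj[E1 E2 Eb] /vec_inj[E3 E4 Ec] [] /vec_inj[E7 E8 Ea].
move=> /vec_inj[E5 E6 Ed] /vec_inj[E9 E10 Ep] /vec_inj[E11 E12 Ew].
have [x3_0 y3_0] := full _ _ (esym Eb) (esym Ec) (esym Ed) (esym Ea)
  (esym Ep) (esym Ew).
exists x1, x2, y1, y2, z1, z2, k.
have := D.
have -> : det3 x1 x2 x3 y1 y2 y3 z1 z2 k = (x1 * y2 - x2 * y1) * k.
  by rewrite /det3 x3_0 y3_0; ring.
rewrite mulf_eq0 negb_or => /andP[D1 k0].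
move: E1 E2 E3 E4 E5 E6 E7 E8 E9 E10 E11 E12.
rewrite x3_0 y3_0 => E1 E2 E3 E4 E5 E6 E7 E8 E9 E10 E11 E12.
split; first by split.
rewrite -E1 -E2 -E3 -E4 -E5 -E6 -E7 -E8 -E9 -E10 -E11 -E12 /bprod.
by do !split; ring.
Qed.

(** A square of dimension 2 cannot be mapped onto one of dimension at most 1: here both the second
    and the third coordinates of X and Y would vanish. *)
Lemma block_square_line b1 b2 c1 c2 d1 d2 a1 a2 p1 p2 w1 w2
    f11 f12 f13 f22 f23 f33 :
  block_full b1 b2 c1 c2 d1 d2 a1 a2 p1 p2 w1 w2 ->
  ~ alg_isomorphic (btab b1 b2 c1 c2 d1 d2 a1 a2 p1 p2 w1 w2)
      (table (vec f11 0 0) (vec f12 0 0) (vec f13 0 0) (vec f22 0 0)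
        (vec f23 0 0) (vec f33 0 0)).
Proof.
move=> full /iso_table_coords[x1 [x2 [x3 [y1 [y2 [y3 [z1 [z2 [k]]]]]]]]] /=.
rewrite !table_mul_vec /comb !vecE !vec_coord => -[D].
rewrite !(mulr0, addr0, mul0r).
move=> /vec_inj[_ E2 Eb] /vec_inj[_ E4 Ec] [] /vec_inj[_ E8 Ea].
move=> /vec_inj[_ E6 Ed] /vec_inj[_ E10 Ep] /vec_inj[_ E12 Ew].
have [x3_0 y3_0] := full _ _ (esym Eb) (esym Ec) (esym Ed) (esym Ea)
  (esym Ep) (esym Ew).
have [x2_0 y2_0] := full _ _ (esym E2) (esym E4) (esym E6) (esym E8)
  (esym E10) (esym E12).
move: D; rewrite /det3 x3_0 y3_0 x2_0 y2_0 => /eqP; apply; ring.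
Qed.

End BlockTables.

(** * Polynomial reasoning over fields of characteristic zero *)

Module FieldNsatz.
Section X.
Variable K : fieldType.
#[export] Instance Kops : @Ncring.Ring_ops K (0 : K)%R (1 : K)%R
  (fun x y => GRing.add x y) (fun x y => GRing.mul x y)
  (fun x y => GRing.add x (GRing.opp y)) (fun x => GRing.opp x) eq.
Defined.
#[export] Instance Kri : @Ncring.Ring _ _ _ _ _ _ _ _ Kops.
Proof.
constructor.
- exact: RelationClasses.eq_equivalence.
- by move=> x y -> z t ->.
- by move=> x y -> z t ->.
- by move=> x y -> z t ->.
- by move=> x y ->.
- exact: add0r.
- exact: addrC.
- exact: addrA.
- exact: mul1r.
- exact: mulr1.
- exact: mulrA.
- exact: mulrDl.
- by move=> x y z; exact: mulrDr.
- by [].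
- exact: subrr.
Qed.
#[export] Instance Kcri : @Cring.Cring _ _ _ _ _ _ _ _ Kops Kri.
Proof. exact: mulrC. Qed.
#[export] Instance Kdi : @Integral_domain.Integral_domain _ _ _ _ _ _ _ _ Kops Kri Kcri.
Proof.
constructor.
- move=> x y /eqP; rewrite mulf_eq0 => /orP[]/eqP; tauto.
- by apply/eqP; exact: oner_neq0.
Qed.
End X.
Lemma pos_neq0 (K : numDomainType) (x : K) : 0 < x -> x = 0 -> False.
Proof. by move=> /lt0r_neq0/eqP. Qed.

Lemma opp_eq0 (K : numDomainType) (x : K) : - x = 0 -> x = 0.
Proof. by move/eqP; rewrite oppr_eq0 => /eqP. Qed.

Import Nsatz.
                                                                             
               
(** Equalities may reach the carrier through different structure projections; they are restated over
    one carrier so that [nsatz] sees them together. *)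
Ltac equalities_over S :=
  repeat match goal with
  | H : @eq ?T ?a ?b |- _ =>
      tryif constr_eq T S then fail else change (@eq S a b) in H
  end;
  try match goal with |- @eq _ ?a ?b => change (@eq S a b) end.

                                                                    
(** [nsatz] may leave the condition that an integer constant is nonzero. Up to sign it is built from
    ones by sums and products, hence positive. Inequations are fed to it as equations x * y = 1. *)
Ltac fnsatz :=
  try match goal with
  | X : numClosedFieldType |- _ => equalities_over (Num.ClosedField.sort X)
  | X : numFieldType |- _ => equalities_over (Num.NumField.sort X)
  end;
  nsatz;
  try (let Q := fresh "Q" in
    intro Q; simpl in Q;
    unfold Algebra_syntax.equality, Algebra_syntax.addition,
      Algebra_syntax.multiplication, Algebra_syntax.zero, Algebra_syntax.one,
      Algebra_syntax.opposite, Ncring.eq_notation, Ncring.add_notation,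
      Ncring.mul_notation, Ncring.zero_notation, Ncring.one_notation,
      Ncring.opp_notation in Q;
    try (apply opp_eq0 in Q);
    revert Q; apply pos_neq0;
    repeat first [exact: ltr01 | apply: addr_gt0 | apply: mulr_gt0]).
End FieldNsatz.
Import FieldNsatz.

                                 

(** * The isomorphism type of the square is an invariant *)

Section Types.
Variable K : numFieldType.

                                                                          
                                                                           
Inductive btype := SplitT | LocalT | HalfT | NilT.

Definition ttab (t : btype) : K -> K -> K -> K -> K -> K -> algebra K :=
  match t with
  | SplitT => btab 1 0 0 0 0 1
  | LocalT => btab 1 0 0 1 0 0
  | HalfT => btab 1 0 0 0 0 0
  | NilT => btab 0 1 0 0 0 0
  end.

Definition tfull (t : btype) : K -> K -> K -> K -> K -> K -> Prop :=
  match t with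
  | SplitT => block_full 1 0 0 0 0 1
  | LocalT => block_full 1 0 0 1 0 0
  | HalfT => block_full 1 0 0 0 0 0
  | NilT => block_full 0 1 0 0 0 0
  end.

(** The equations for the product on the plane say that the two planes are isomorphic algebras.
    Together with the inverted determinant they are inconsistent for distinct types. *)
Lemma ttab_inj t t' a1 a2 p1 p2 w1 w2 a1' a2' p1' p2' w1' w2' :
  tfull t' a1' a2' p1' p2' w1' w2' ->
  alg_isomorphic (ttab t' a1' a2' p1' p2' w1' w2') (ttab t a1 a2 p1 p2 w1 w2) ->
  t = t'.
Proof.
case: t; case: t' => //= full /(block_coords full).
all: case=> x1 [x2 [y1 [y2 [z1 [z2 [k]]]]]] [] [D _] [] [].
all: rewrite /bprod !(mulr0, mul0r, addr0, add0r, mulr1, mul1r).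
all: move=> E1 E2 E3 E4 [] [E5 E6 _ _] _.
all: have {D} := divff D; move: (_^-1) => d D.
all: exfalso; suff: (1 : K) = 0 by apply/eqP/oner_neq0.
all: fnsatz.
Qed.

End Types.

(** * Labels encoded by type and coefficients *)

Section Labels.
Variable K : numFieldType.
Implicit Types l : A_label K.

Definition A_line l := match l with A29 | A30 => true | _ => false end.

                                                                              
(** [A29] and [A30], whose square is a line, fall into the default case; their type is a
    placeholder, as are their zero coefficients in [A_coef]. *)
Definition A_type l : btype :=
  match l with
  | A01 _ _ _ | A02 _ => SplitT
  | A12 _ _ | A13 _ | A14 _ | A15 _ | A16 | A17 | A18 | A19 | A20 => LocalT
  | A21 _ | A22 | A23 | A24 _ | A25 | A26 | A27 | A28 => NilT
  | _ => HalfT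
  end.

Definition A_coef l : K * K * K * K * K * K :=
  match l with
  | A01 a b c => (0, a, b, 0, 1, c)
  | A02 a => (0, 1, a, 0, 0, 0)
  | A03 a => (0, 0, 0, 1, a, 0)
  | A04 a => (0, 0, 1, 1, a, 0)
  | A05 a b => (0, 1, a, 1, b, 0)
  | A06 a => (0, 1, 1, 0, 0, a)
  | A07 => (0, 1, 0, 0, 0, 0)
  | A08 => (0, 1, 0, 0, 0, 1)
  | A09 a => (0, 1, 0, 0, 1, a)
  | A10 => (0, 0, 1, 0, 0, 1)
  | A11 => (0, 0, 0, 0, 1, 1)
  | A12 a b => (1, 0, a, 0, b, 1)
  | A13 a => (1, 0, 1, 0, a, 0)
  | A14 a => (1, 0, 0, 0, a, 0)
  | A15 a => (0, 0, 1, 0, 1, a)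
  | A16 => (0, 0, 0, 0, 1, 1)
  | A17 => (0, 0, 0, 0, 1, 0)
  | A18 => (0, 0, 1, 0, 0, 1)
  | A19 => (0, 0, 1, 0, 0, 0)
  | A20 => (0, 0, 0, 0, 0, 1)
  | A21 a => (0, 0, 1, 1, 0, a)
  | A22 => (0, 0, 1, 0, 0, 0)
  | A23 => (0, 0, 1, 0, 0, 1)
  | A24 a => (1, 0, 0, a, 0, 0)
  | A25 => (1, 0, 0, 0, 0, 1)
  | A26 => (1, 1, 0, 1, 0, 0)
  | A27 => (0, 0, 0, 0, 1, 0)
  | A28 => (0, 0, 0, 1, 1, 0)
  | A29 | A30 => (0, 0, 0, 0, 0, 0)
  end.

Definition ctab t (c : K * K * K * K * K * K) : algebra K :=
  let: (a1, a2, p1, p2, w1, w2) := c in ttab t a1 a2 p1 p2 w1 w2.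

Definition cfull t (c : K * K * K * K * K * K) : Prop :=
  let: (a1, a2, p1, p2, w1, w2) := c in tfull t a1 a2 p1 p2 w1 w2.

Lemma table_eq p11 p12 p13 p22 p23 p33 q11 q12 q13 q22 q23 q33 :
  p11 = q11 -> p12 = q12 -> p13 = q13 -> p22 = q22 -> p23 = q23 -> p33 = q33 ->
  table p11 p12 p13 p22 p23 p33 = table (K := K) q11 q12 q13 q22 q23 q33.
Proof. by do 6!move=> ->. Qed.

Lemma vec_eq (a b c a' b' c' : K) :
  a = a' -> b = b' -> c = c' -> vec a b c = vec a' b' c'.
Proof. by do 3!move=> ->. Qed.

Lemma A_ctab l : ~~ A_line l -> A_algebra l = ctab (A_type l) (A_coef l).
Proof.
case: l => [a b c|a|a|a|a b|a| | |a| | |a b|a|a|a| | | | | |a| | |a| | | | | | ] nl.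
all: try discriminate nl.
all: rewrite /A_algebra /A_coef /A_type /ctab /ttab /btab.
all: rewrite ?vec1 ?vec2 ?vecZ ?vecD (@vec0 K).
all: apply: table_eq; apply: vec_eq; ring.
Qed.

Lemma A_full l : ~~ A_line l -> cfull (A_type l) (A_coef l).
Proof.
case: l => [a b c|a|a|a|a b|a| | |a| | |a b|a|a|a| | | | | |a| | |a| | | | | |] //= _ s t.
all: rewrite !(mul0r, mul1r, addr0, add0r) => E1 E2 E3 E4 E5 E6.
all: split; fnsatz.
Qed.

Lemma A_type_inj l l' : ~~ A_line l -> ~~ A_line l' ->
  alg_isomorphic (A_algebra l) (A_algebra l') -> A_type l = A_type l'.
Proof.
move=> nl nl'; have := A_full nl; rewrite (A_ctab nl) (A_ctab nl').
case: (A_coef l) => [[[[[? ?] ?] ?] ?] ?]; case: (A_coef l') => [[[[[? ?] ?] ?] ?] ?].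
by move=> full /(ttab_inj full).
Qed.

End Labels.

(** * Comparing algebras within one type *)

Section Classes.
Variable K : numFieldType.
Implicit Types l : A_label K.

Lemma A_coords l l' : ~~ A_line l -> ~~ A_line l' -> A_type l = A_type l' ->
  alg_isomorphic (A_algebra l) (A_algebra l') ->
  let: (a1, a2, p1, p2, w1, w2) := A_coef l' in
  let: (a1', a2', p1', p2', w1', w2') := A_coef l in
  exists x1 x2 y1 y2 z1 z2 k,
  match A_type l' with
  | SplitT => block_change 1 0 0 0 0 1 a1 a2 p1 p2 w1 w2
      1 0 0 0 0 1 a1' a2' p1' p2' w1' w2' x1 x2 y1 y2 z1 z2 k
  | LocalT => block_change 1 0 0 1 0 0 a1 a2 p1 p2 w1 w2
      1 0 0 1 0 0 a1' a2' p1' p2' w1' w2' x1 x2 y1 y2 z1 z2 k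
  | HalfT => block_change 1 0 0 0 0 0 a1 a2 p1 p2 w1 w2
      1 0 0 0 0 0 a1' a2' p1' p2' w1' w2' x1 x2 y1 y2 z1 z2 k
  | NilT => block_change 0 1 0 0 0 0 a1 a2 p1 p2 w1 w2
      0 1 0 0 0 0 a1' a2' p1' p2' w1' w2' x1 x2 y1 y2 z1 z2 k
  end.
Proof.
move=> nl nl' tt'; have := A_full nl; rewrite (A_ctab nl) (A_ctab nl') tt'.
case: (A_coef l) => [[[[[? ?] ?] ?] ?] ?]; case: (A_coef l') => [[[[[? ?] ?] ?] ?] ?].
by case: (A_type l') => full /(block_coords full).
Qed.

(** The vector e1 is the unit of the plane, hence fixed, and e2 spans its radical, hence is scaled
    by t. Since e1e3 has no e2 component on either side, e3 goes to z e1 + k e3. *)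
Lemma local_coords a1 p1 p2 w1 w2 a1' p1' p2' w1' w2' (x1 x2 y1 y2 z1 z2 k : K) :
  block_change 1 0 0 1 0 0 a1 0 p1 p2 w1 w2
    1 0 0 1 0 0 a1' 0 p1' p2' w1' w2' x1 x2 y1 y2 z1 z2 k ->
  exists t z ti ki : K, [/\ t * ti = 1, k * ki = 1, z + k * a1 = a1',
    k * t * p1 = p1' & [/\ z + k * p2 = p2',
    z * z + (k * z * a1 + k * z * a1) + k * k * w1 = w1' & k * k * w2 = w2' * t]].
Proof.
case=> -[D kk] [] [];
  rewrite /bprod !(mul0r, mulr0, mul1r, mulr1, add0r, addr0) ?mulr2n.
move=> E1 E2 E3 E4 [] [E5 E6 E7 E8] [E9 E10 E11 E12].
have {D} := divff D; have {kk} := divff kk.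
(* From here on [d] is the inverse of k, while [ki] is the inverse of the 2 by 2 determinant; the
   same holds in the next three lemmas. *)
move: (_^-1) (_^-1) => ki d kk D.
have y1_0 : y1 = 0.
  clear E7 E8 E9 E10 E11 E12. fnsatz.
have x1_1 : x1 = 1.
  clear E7 E8 E9 E10 E11 E12. fnsatz.
have x2_0 : x2 = 0.
  clear E7 E8 E9 E10 E11 E12. fnsatz.
subst x1 x2 y1.
move: E7 E8 E9 E10 E11 E12 D.
rewrite !(mul0r, mulr0, mul1r, mulr1, add0r, addr0, subr0) => E7 E8 E9 E10 E11 E12 D.
subst z2; exists y2, z1, ki, d; clear E1 E2 E3 E4 E5 E6.
do !split => //.
all: fnsatz.
Qed.
(** The plane has a single nonzero idempotent e1 and its annihilator is spanned by e2. The
    normalisation of e1e3 forbids an e1 component in the image of e3. *)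
Lemma half_coords a p1 p2 w1 w2 a' p1' p2' w1' w2' (x1 x2 y1 y2 z1 z2 k : K) :
  block_change 1 0 0 0 0 0 0 a p1 p2 w1 w2
    1 0 0 0 0 0 0 a' p1' p2' w1' w2' x1 x2 y1 y2 z1 z2 k ->
  exists t z ti ki : K, [/\ t * ti = 1, k * ki = 1, k * a = t * a',
    k * t * p1 = p1' & [/\ k * p2 = p2',
    k * z * p1 + k * z * p1 + k * k * w1 = w1' &
    k * z * p2 + k * z * p2 + k * k * w2 = w2' * t]].
Proof.
case=> -[D kk] [] [];
  rewrite /bprod !(mul0r, mulr0, mul1r, mulr1, add0r, addr0) ?mulr2n.
move=> E1 E2 E3 _ [] [E5 _ E7 E8] [E9 E10 E11 E12].
have {D} := divff D; have {kk} := divff kk.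
move: (_^-1) (_^-1) => ki d kk D.
have x1_1 : x1 = 1.
  clear E7 E8 E9 E10 E11 E12; fnsatz.
have y1_0 : y1 = 0.
  clear E7 E8 E9 E10 E11 E12; fnsatz.
subst x1 x2 y1.
move: E7 E8 E9 E10 E11 E12 D.
rewrite !(mul0r, mulr0, mul1r, mulr1, add0r, addr0, subr0) => E7 E8 E9 E10 E11 E12 D.
subst z1; exists y2, z2, ki, d; clear E1 E3 E5.
do !split => //.
all: fnsatz.
Qed.

(** An automorphism of the plane sends e1 to s e1 + r e2, hence e2 = e1e1 to s^2 e2; the plane part
    of the image of e3 stays free. *)
Lemma nil_coords a1 a2 p1 p2 w1 w2 a1' a2' p1' p2' w1' w2'
    (x1 x2 y1 y2 z1 z2 k : K) :
  block_change 0 1 0 0 0 0 a1 a2 p1 p2 w1 w2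
    0 1 0 0 0 0 a1' a2' p1' p2' w1' w2' x1 x2 y1 y2 z1 z2 k ->
  exists s r si ki : K, [/\ s * si = 1, k * ki = 1,
    k * (s * a1 + r * p1) = a1' * s,
    s * z1 + k * (s * a2 + r * p2) = a1' * r + a2' * (s * s) &
    [/\ k * s * p1 = p1', k * (s * s) * p2 = p1' * r + p2' * (s * s),
    k * (z1 * a1 + z2 * p1) + k * (z1 * a1 + z2 * p1) + k * k * w1 = w1' * s &
    z1 * z1 + (k * (z1 * a2 + z2 * p2) + k * (z1 * a2 + z2 * p2)) + k * k * w2
      = w1' * r + w2' * (s * s)]].
Proof.
case=> -[D kk] [] [];
  rewrite /bprod !(mul0r, mulr0, mul1r, mulr1, add0r, addr0) ?mulr2n.
move=> E1 E2 E3 _ [] [_ E6 E7 E8] [E9 E10 E11 E12].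
have {D} := divff D; have {kk} := divff kk.
move: (_^-1) (_^-1) => ki d kk D.
subst y1 y2.
move: E7 E8 E9 E10 E11 E12 D.
rewrite !(mul0r, mulr0, mul1r, mulr1, add0r, addr0, subr0) => E7 E8 E9 E10 E11 E12 D.
(* The determinant is x1^3, so x1^2 times its inverse inverts x1. *)
exists x1, x2, (x1 * x1 * ki), d; clear E3 E6.
do !split => //.
all: fnsatz.
Qed.

(** The plane has exactly two primitive idempotents, which are fixed or exchanged; the normalisation
    then leaves only the scaling of e3. *)
Lemma split_coords a p w1 w2 a' p' w1' w2' (x1 x2 y1 y2 z1 z2 k : K) :
  block_change 1 0 0 0 0 1 0 a p 0 w1 w2
    1 0 0 0 0 1 0 a' p' 0 w1' w2' x1 x2 y1 y2 z1 z2 k ->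
  exists ki : K, k * ki = 1 /\
  ([/\ a' = k * a, p' = k * p, w1' = k * k * w1 & w2' = k * k * w2]
   \/ [/\ a' = k * p, p' = k * a, w1' = k * k * w2 & w2' = k * k * w1]).
Proof.
case=> -[D kk] [] [];
  rewrite /bprod !(mul0r, mulr0, mul1r, mulr1, add0r, addr0) ?mulr2n.
move=> E1 E2 E3 E4 [] [E5 E6 E7 E8] [E9 E10 E11 E12].
have {D} := divff D; have {kk} := divff kk.
move: (_^-1) (_^-1) => ki d kk D.
exists d; split=> //.
have [x1_0|x1_1] : x1 = 0 \/ x1 = 1.
- have /eqP : x1 * (x1 - 1) = 0 by rewrite mulrBr E1 mulr1 subrr.
  by rewrite mulf_eq0 subr_eq0 => /orP[]/eqP; [left|right].
- have y1_1 : y1 = 1 by clear E7 E8 E9 E10 E11 E12; fnsatz.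
  have x2_1 : x2 = 1 by clear E7 E8 E9 E10 E11 E12; fnsatz.
  have y2_0 : y2 = 0 by clear E7 E8 E9 E10 E11 E12; fnsatz.
  subst x1 x2 y1 y2; clear E1 E2 E3 E4 E5 E6.
  by right; split; fnsatz.
- have y1_0 : y1 = 0 by clear E7 E8 E9 E10 E11 E12; fnsatz.
  have x2_0 : x2 = 0 by clear E7 E8 E9 E10 E11 E12; fnsatz.
  have y2_1 : y2 = 1 by clear E7 E8 E9 E10 E11 E12; fnsatz.
  subst x1 x2 y1 y2; clear E1 E2 E3 E4 E5 E6.
  by left; split; fnsatz.
Qed.

                                                                           
Ltac refute := exfalso; suff: (1 : K) = 0 by [apply/eqP/oner_neq0|]; fnsatz.

Lemma eq_or_opp (a b : K) : a * a = b * b -> b = a \/ b = - a.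
Proof.
move=> E; have /eqP : (b - a) * (b + a) = 0 by rewrite -subr_sqr !expr2 E subrr.
by rewrite mulf_eq0 subr_eq0 addr_eq0 => /orP[]/eqP; [left|right].
Qed.

Lemma local_class l l' : A_type l = LocalT -> A_type l' = LocalT ->
  alg_isomorphic (A_algebra l) (A_algebra l') -> same_class l l'.
Proof.
move=> tl tl'.
have nl : ~~ A_line l by case: l tl => //.
have nl' : ~~ A_line l' by case: l' tl' => //.
have tt' : A_type l = A_type l' by rewrite tl tl'.
move/(A_coords nl nl' tt').
case: l tl {nl tt'} => //= [a b _|a _|a _|a _|_|_|_|_|_].
all: case: l' tl' {nl'} => //= [a' b' _|a' _|a' _|a' _|_|_|_|_|_].
all: case=> [x1 [x2 [y1 [y2 [z1 [z2 [k]]]]]]] /local_coords[t [z [ti [ki []]]]].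
all: move=> F1 F2 F3 F4 [F5 F6 F7].
(* Pairs with different constructors have inconsistent equations; what survives is one constructor
   with its parameters to be compared. *)
all: match goal with
  | |- same_class ?f ?f => exact: Relation_Operators.rst_refl
  | |- same_class (?f _ _) (?f _ _) => idtac
  | |- same_class (?f _) (?f _) => idtac
  | |- _ => refute
  end.
- have ea : a = a' by fnsatz.
  have eb : b = b' by fnsatz.
  by rewrite ea eb; exact: Relation_Operators.rst_refl.
- have ea : a = a' by fnsatz.
  by rewrite ea; exact: Relation_Operators.rst_refl.
- have ea : a = a' by fnsatz.
  by rewrite ea; exact: Relation_Operators.rst_refl.
- have [->|->] : a' = a \/ a' = - a by apply: eq_or_opp; fnsatz.
    exact: Relation_Operators.rst_refl.
  exact/Relation_Operators.rst_step/A15_sign.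
Qed.

Lemma half_class l l' : ~~ A_line l -> ~~ A_line l' ->
  A_type l = HalfT -> A_type l' = HalfT ->
  alg_isomorphic (A_algebra l) (A_algebra l') -> same_class l l'.
Proof.
move=> nl nl' tl tl'.
have tt' : A_type l = A_type l' by rewrite tl tl'.
move/(A_coords nl nl' tt').
case: l tl nl {tt'} => //= [a _ _|a _ _|a b _ _|a _ _|_ _|_ _|a _ _|_ _|_ _].
all: case: l' tl' nl' => //= [a' _ _|a' _ _|a' b' _ _|a' _ _|_ _|_ _|a' _ _|_ _|_ _].
all: case=> [x1 [x2 [y1 [y2 [z1 [z2 [k]]]]]]] /half_coords[t [z [ti [ki []]]]].
all: move=> F1 F2 F3 F4 [F5 F6 F7].
all: match goal with
  | |- same_class ?f ?f => exact: Relation_Operators.rst_refl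
  | |- same_class (?f _ _) (?f _ _) => idtac
  | |- same_class (?f _) (?f _) => idtac
  | |- _ => refute
  end.
- have ea : a = a' by fnsatz.
  by rewrite ea; exact: Relation_Operators.rst_refl.
- have ea : a = a' by fnsatz.
  by rewrite ea; exact: Relation_Operators.rst_refl.
- have ea : a = a' by fnsatz.
  have eb : b = b' by fnsatz.
  by rewrite ea eb; exact: Relation_Operators.rst_refl.
- have [->|->] : a' = a \/ a' = - a by apply: eq_or_opp; fnsatz.
    exact: Relation_Operators.rst_refl.
  exact/Relation_Operators.rst_step/A06_sign.
- have [->|->] : a' = a \/ a' = - a by apply: eq_or_opp; fnsatz.
    exact: Relation_Operators.rst_refl.
  exact/Relation_Operators.rst_step/A09_sign.
Qed.

Lemma nil_class l l' : A_type l = NilT -> A_type l' = NilT ->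
  alg_isomorphic (A_algebra l) (A_algebra l') -> same_class l l'.
Proof.
move=> tl tl'.
have nl : ~~ A_line l by case: l tl => //.
have nl' : ~~ A_line l' by case: l' tl' => //.
have tt' : A_type l = A_type l' by rewrite tl tl'.
move/(A_coords nl nl' tt').
case: l tl {nl tt'} => //= [a _|_|_|a _|_|_|_|_].
all: case: l' tl' {nl'} => //= [a' _|_|_|a' _|_|_|_|_].
all: case=> [x1 [x2 [y1 [y2 [z1 [z2 [k]]]]]]] /nil_coords[s [r [si [ki []]]]].
all: move=> F1 F2 F3 F4 [F5 F6 F7 F8].
all: match goal with
  | |- same_class ?f ?f => exact: Relation_Operators.rst_refl
  | |- same_class (?f _) (?f _) => idtac
  | |- _ => refute
  end.
- have ea : a = a' by fnsatz.
  by rewrite ea; exact: Relation_Operators.rst_refl.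
- have ea : a = a' by fnsatz.
  by rewrite ea; exact: Relation_Operators.rst_refl.
Qed.

End Classes.

(** * The isomorphism relation on the A list *)

Section Isomorphisms.
Variable K : numFieldType.
Implicit Types l : A_label K.

Lemma split_class l l' : A_type l = SplitT -> A_type l' = SplitT ->
  alg_isomorphic (A_algebra l) (A_algebra l') -> same_class l l'.
Proof.
move=> tl tl'.
have nl : ~~ A_line l by case: l tl => //.
have nl' : ~~ A_line l' by case: l' tl' => //.
have tt' : A_type l = A_type l' by rewrite tl tl'.
move/(A_coords nl nl' tt').
case: l tl {nl tt'} => //= [a b c _|a _].
all: case: l' tl' {nl'} => //= [a' b' c' _|a' _].
all: case=> [x1 [x2 [y1 [y2 [z1 [z2 [k]]]]]]] /split_coords[ki [kk []]] [].
all: rewrite ?(mul0r, mulr0, mul1r, mulr1, add0r, addr0) => F1 F2 F3 F4.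
all: try by (exfalso; suff: (1 : K) = 0 by [apply/eqP/oner_neq0|]; fnsatz).
- have /eqP : (k - 1) * (k + 1) = 0 by fnsatz.
  rewrite mulf_eq0 subr_eq0 addr_eq0 => /orP[]/eqP k1.
    rewrite F1 F2 F4 k1 !mul1r; exact: Relation_Operators.rst_refl.
  rewrite F1 F2 F4 k1 mulrNN !mul1r !mulN1r.
  exact/Relation_Operators.rst_sym/Relation_Operators.rst_step/A01_sign.
(* The idempotents are exchanged: 1 = k^2 c', so the inverse of k serves as the square root s of
   [A01_swap], read from the second label to the first. *)
- have c'E : c' = (ki ^+ 2) by rewrite expr2; fnsatz.
  have c'0 : c' != 0.
    by rewrite c'E expf_neq0 //; apply/eqP => k0; move: kk; rewrite k0 mulr0
      => /eqP; rewrite eq_sym oner_eq0.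
  have cE : c = c'^-1 by apply: (mulIf c'0); rewrite mulVf // c'E expr2; fnsatz.
  have kE : k = ki^-1.
    by rewrite -[k]mulr1 -(mulfV (x := ki)) ?mulrA ?kk ?mul1r //;
      move: c'0; rewrite c'E expf_eq0.
  rewrite F1 F2 cE [k * a']mulrC [k * b']mulrC kE.
  exact/Relation_Operators.rst_sym/Relation_Operators.rst_step/A01_swap.
- have -> : a = a' by fnsatz.
  exact: Relation_Operators.rst_refl.
- have a'0 : a' != 0.
    by apply/eqP => a0; move: F1; rewrite a0 mulr0 => /eqP; rewrite oner_eq0.
  have -> : a = a'^-1 by apply: (mulIf a'0); rewrite mulVf //; fnsatz.
  exact/Relation_Operators.rst_sym/Relation_Operators.rst_step/A02_inv.
Qed.

Lemma A_line_iso l l' : alg_isomorphic (A_algebra l) (A_algebra l') ->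
  A_line l = A_line l'.
Proof.
have lineP (m m' : A_label K) : A_line m -> ~~ A_line m' ->
    ~ alg_isomorphic (A_algebra m') (A_algebra m).
  move=> lm nm'; have := A_full nm'; rewrite (A_ctab nm').
  case: (A_coef m') => [[[[[a1 a2] p1] p2] w1] w2] full.
  case: m lm => // _; rewrite /A_algebra vec1 (@vec0 K).
    by move: full; rewrite /ctab /cfull; case: (A_type m'); exact: block_square_line.
  by move: full; rewrite /ctab /cfull; case: (A_type m'); exact: block_square_line.
move=> iso; case: (boolP (A_line l)) (boolP (A_line l')) => [ll|nl] [] //.
- by move=> nl'; case: (lineP l l' ll nl'); exact: alg_iso_sym.
- by move=> ll'; case: (lineP l' l ll' nl).
Qed.

                                                         
(** Both products are a symmetric form times e1. In [A30] the vector e2 is in the radical, while the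
    form of [A29] is nondegenerate. *)
Lemma A30_A29 :
  ~ alg_isomorphic (A_algebra (A30 K)) (A_algebra (A29 K)).
Proof.
rewrite /A_algebra vec1 (@vec0 K).
move=> /iso_table_coords[x1 [x2 [x3 [y1 [y2 [y3 [z1 [z2 [z3]]]]]]]]] /=.
rewrite !table_mul_vec /comb !vecE !vec_coord => -[D].
rewrite !(mulr0, addr0, mul0r, add0r, mulr1, mul1r).
move=> /vec_inj[E1 E2 E3] /vec_inj[E4 _ _] [] _.
move=> /vec_inj[E5 _ _] /vec_inj[E6 _ _] _.
move: D; rewrite /det3 => /divff; move: (_^-1) => d D.
exfalso; suff: (1 : K) = 0 by [apply/eqP/oner_neq0|].
subst x2 x3; fnsatz.
Qed.

Lemma iso_same_class l l' :
  alg_isomorphic (A_algebra l) (A_algebra l') -> same_class l l'.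
Proof.
move=> iso; have := A_line_iso iso.
case: (boolP (A_line l)) => nl; case: (boolP (A_line l')) => // nl' _.
  case: l nl iso => // _; case: l' nl' => // _ iso.
  - exact: Relation_Operators.rst_refl.
  - by case: A30_A29; exact: alg_iso_sym.
  - by case: A30_A29.
  - exact: Relation_Operators.rst_refl.
have tt' := A_type_inj nl nl' iso.
have tl' := esym tt'; case tl: (A_type l); rewrite tl in tl'.
- exact: split_class.
- exact: local_class.
- exact: half_class.
- exact: nil_class.
Qed.

Ltac nonzero :=
  rewrite ?(mulf_neq0, oppr_eq0, invr_eq0, oner_neq0, mul0r, mulr0, mul1r,
    mulr1, sub0r, subr0) //.

Tactic Notation "block" uconstr(u1) uconstr(u2) uconstr(v1) uconstr(v2)
    uconstr(r1) uconstr(r2) uconstr(q) :=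
  refine (block_iso (x1 := u1) (x2 := u2) (y1 := v1) (y2 := v2)
            (z1 := r1) (z2 := r2) (k := q) _);
  split; [by split; nonzero
         | by rewrite /bprod; do !split; (ring || (field; nonzero))].

Lemma exceptional_iso l l' :
  exceptional l l' -> alg_isomorphic (A_algebra l) (A_algebra l').
Proof.
case=> {l l'} [a b c|a b c s c0 sc|a a0|a|a|a]; rewrite !A_ctab //.
- by block 1 0 0 1 0 0 (-1).
- have s0 : s != 0 by move: c0; rewrite -sc expf_eq0.
  by rewrite -sc; block 0 1 1 0 0 0 s^-1.
- by block 0 1 1 0 0 0 a^-1.
- by block 1 0 0 (-1) 0 0 (-1).
- by block 1 0 0 (-1) 0 0 (-1).
- by block 1 0 0 (-1) 0 0 (-1).
Qed.

Lemma A_algebra_iso l l' :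
  alg_isomorphic (A_algebra l) (A_algebra l') <-> same_class l l'.
Proof.
split; first exact: iso_same_class.
elim=> {l l'} [l l'|l|l l' _|l m l' _ lm _].
- exact: exceptional_iso.
- exact: alg_iso_refl.
- exact: alg_iso_sym.
- exact: alg_iso_trans.
Qed.

End Isomorphisms.

                                      

(** * Membership in the lists *)

Section Listed.
Variable K : numClosedFieldType.
Implicit Types A B : algebra K.

Definition listed A :=
  (exists l : M_label K, alg_isomorphic A (M_algebra l)) \/
  (exists l : J_label, alg_isomorphic A (J_algebra K l)) \/
  (exists l : A_label K, alg_isomorphic A (A_algebra l)).

Lemma listed_iso A B : alg_isomorphic A B -> listed B -> listed A.
Proof.
move=> AB [[l Bl]|[[l Bl]|[l Bl]]]; [left|right; left|right; right]; exists l;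
  exact: alg_iso_trans AB Bl.
Qed.

Lemma listedM A l : alg_isomorphic A (M_algebra l) -> listed A.
Proof. by move=> Al; left; exists l. Qed.

Lemma listedJ A l : alg_isomorphic A (J_algebra K l) -> listed A.
Proof. by move=> Al; right; left; exists l. Qed.

Lemma listedA A l : alg_isomorphic A (A_algebra l) -> listed A.
Proof. by move=> Al; right; right; exists l. Qed.

(** Giving the inverse d of the determinant turns invertibility into one more polynomial equation,
    next to the six products. *)
Lemma iso_tables_inv p11 p12 p13 p22 p23 p33 q11 q12 q13 q22 q23 q33
    x1 x2 x3 y1 y2 y3 z1 z2 z3 d :
  let P : algebra K := table p11 p12 p13 p22 p23 p33 in
  let X : P := vec x1 x2 x3 in let Y : P := vec y1 y2 y3 in
  let Z : P := vec z1 z2 z3 in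
  det3 x1 x2 x3 y1 y2 y3 z1 z2 z3 * d = 1 ->
  X ** X = comb X Y Z q11 -> X ** Y = comb X Y Z q12 ->
  X ** Z = comb X Y Z q13 -> Y ** Y = comb X Y Z q22 ->
  Y ** Z = comb X Y Z q23 -> Z ** Z = comb X Y Z q33 ->
  alg_isomorphic P (table q11 q12 q13 q22 q23 q33).
Proof.
move=> P X Y Z D; apply: iso_tables; apply/eqP => D0.
by move/eqP: D; rewrite D0 mul0r eq_sym oner_eq0.
Qed.

End Listed.

(* The nine first arguments are the rows of the new basis, the tenth is the inverse of its
   determinant. *)
Tactic Notation "tab" uconstr(a1) uconstr(a2) uconstr(a3) uconstr(b1)
    uconstr(b2) uconstr(b3) uconstr(c1) uconstr(c2) uconstr(c3) uconstr(e) :=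
  refine (iso_tables_inv (x1 := a1) (x2 := a2) (x3 := a3)
    (y1 := b1) (y2 := b2) (y3 := b3) (z1 := c1) (z2 := c2) (z3 := c3)
    (d := e) _ _ _ _ _ _ _);
  [rewrite /det3|..];
  rewrite ?vec1 ?vec2 ?vec3 ?vecZ ?vecD ?(@vec0 _) /= ?table_mul_vec
    /comb ?vec_coord ?vecZ ?vecD;
  try apply: vec_eq.

(** * Products with values in a line *)

Section LineTables.
Variable K : numClosedFieldType.

Lemma inverse (x : K) : x != 0 -> exists y, x * y = 1.
Proof. by move=> x0; exists x^-1; exact: divff. Qed.

Lemma square_root (x : K) : exists y, y * y = x.
Proof. by exists (sqrtC x); rewrite -expr2 sqrtCK. Qed.

Lemma half_exists : exists h : K, h + h = 1.
Proof.
exists 2%:R^-1; rewrite -mulr2n -[_ *+ 2]mulr_natr mulVf //.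
by rewrite pnatr_eq0.
Qed.

Definition form (a b c x1 y1 x2 y2 : K) :=
  a * x1 * x2 + b * (x1 * y2 + x2 * y1) + c * y1 * y2.

(** Gram matrices of rank 0, 1 and 2 (a hyperbolic plane) in the basis (x1, y1), (x2, y2); d inverts
    the determinant. *)
Definition normal_form (a b c x1 y1 x2 y2 d : K) :=
  (x1 * y2 - x2 * y1) * d = 1 /\
  [\/ [/\ form a b c x1 y1 x1 y1 = 0, form a b c x1 y1 x2 y2 = 0 &
          form a b c x2 y2 x2 y2 = 0],
      [/\ form a b c x1 y1 x1 y1 = 0, form a b c x1 y1 x2 y2 = 0 &
          form a b c x2 y2 x2 y2 = 1] |
      [/\ form a b c x1 y1 x1 y1 = 0, form a b c x1 y1 x2 y2 = 1 &
          form a b c x2 y2 x2 y2 = 0]].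

(** With r^2 = b^2 - ac, the isotropic vectors are ((r - b) / a, 1) and ((- r - b) / a, 1). They
    coincide in rank 1 and span a hyperbolic plane in rank 2. *)
Lemma binary_form_neq0 (a b c : K) : a != 0 ->
  exists x1 y1 x2 y2 d, normal_form a b c x1 y1 x2 y2 d.
Proof.
move=> a0; have [ai aK] := inverse a0.
have [r rK] := square_root (b * b - a * c).
have [r0|r0] := eqVneq r 0.
  have [s sK] := square_root ai.
  exists (- b * ai), 1, s, 0, (- s * a); rewrite /normal_form /form; split.
    by fnsatz.
  constructor 2; split; fnsatz.
have [ri rK'] := inverse r0; have [h hK] := half_exists.
(* The two isotropic vectors pair to - 2 r^2 / a; m normalises this value to 1. *)
pose m := - a * h * ri * ri.
exists ((r - b) * ai), 1, (m * ((- b - r) * ai)), m, (- r).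
rewrite /normal_form /form /m; split.
  by fnsatz.
constructor 3; split; fnsatz.
Qed.

Lemma binary_form (a b c : K) :
  exists x1 y1 x2 y2 d, normal_form a b c x1 y1 x2 y2 d.
Proof.
have [a0|a0] := eqVneq a 0; last exact: binary_form_neq0.
have [c0|c0] := eqVneq c 0; last first.
  have [y1 [x1 [y2 [x2 [d]]]]] := binary_form_neq0 b a c0.
  rewrite /normal_form /form => -[D F]; exists x1, y1, x2, y2, (- d).
  split; first by rewrite -D; ring.
  case: F => -[F1 F2 F3]; [constructor 1|constructor 2|constructor 3];
    by split; fnsatz.
have [b0|b0] := eqVneq b 0.
  exists 1, 0, 0, 1, 1; rewrite /normal_form /form a0 b0 c0.
  by split; [ring|constructor 1; split; ring].
have [bi bK] := inverse b0.
exists 1, 0, 0, bi, b; rewrite /normal_form /form a0 c0.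
by split; [fnsatz|constructor 3; split; fnsatz].
Qed.

Definition ltab (f11 f12 f13 f22 f23 f33 : K) : algebra K :=
  table (vec f11 0 0) (vec f12 0 0) (vec f13 0 0) (vec f22 0 0)
    (vec f23 0 0) (vec f33 0 0).

(** Scaling e1 by 1 / f11 makes it idempotent and its orthogonal complement is a binary form. The
    form used here is f on that complement times f11, as products are now measured in e1 / f11. *)
Lemma ltab_idempotent (f11 f12 f13 f22 f23 f33 : K) : f11 != 0 ->
  listed (ltab f11 f12 f13 f22 f23 f33).
Proof.
move=> f0; have [g gK] := inverse f0.
have [x1 [y1 [x2 [y2 [d [D F]]]]]] := binary_form (f11 * f22 - f12 * f12)
  (f11 * f23 - f12 * f13) (f11 * f33 - f13 * f13).
case: F; rewrite /form => -[F1 F2 F3].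
- apply: (@listedJ _ _ J03).
  tab g 0 0 (- g * (x1 * f12 + y1 * f13)) x1 y1
    (- g * (x2 * f12 + y2 * f13)) x2 y2 (f11 * d);
    try ring; fnsatz.
- apply: (@listedA _ _ (A30 K)).
  tab g 0 0 (- g * (x1 * f12 + y1 * f13)) x1 y1
    (- g * (x2 * f12 + y2 * f13)) x2 y2 (f11 * d);
    try ring; fnsatz.
- apply: (@listedA _ _ (A29 K)).
  tab g 0 0 (- g * (x1 * f12 + y1 * f13)) x1 y1
    (- g * (x2 * f12 + y2 * f13)) x2 y2 (f11 * d);
    try ring; fnsatz.
Qed.

(** Here e1 is isotropic but outside the radical. It forms a hyperbolic pair with e3, and f22 alone
    decides between rank 2 and rank 3. *)
Lemma ltab_isotropic (f13 f22 f23 f33 : K) : f13 != 0 ->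
  listed (ltab 0 0 f13 f22 f23 f33).
Proof.
move=> f0; have [g gK] := inverse f0; have [h hK] := half_exists.
have [f22_0|f22_0] := eqVneq f22 0.
  apply: (@listedM _ _ (M04 0)).
  tab 1 0 0 (- f23 * g) 1 0 (- h * g * g * f33) 0 g f13;
    try ring; fnsatz.
have [r rK] := square_root f22; have r0 : r != 0.
  by apply: contra_neq f22_0; rewrite -rK => ->; rewrite mul0r.
have [s sK] := inverse r0.
apply: (@listedM _ _ (M07 K)).
tab 1 0 0 (- f23 * g * s) s 0 (- h * g * g * f33) 0 g (r * f13);
  try ring; fnsatz.
Qed.

Lemma ltab_listed f11 f12 f13 f22 f23 f33 :
  nontrivial (ltab f11 f12 f13 f22 f23 f33) ->
  listed (ltab f11 f12 f13 f22 f23 f33).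
Proof.
have [->|f0] := eqVneq f11 0; last by move=> _; exact: ltab_idempotent.
have [->|f13_0] := eqVneq f13 0; last first.
  move=> _; have [g gK] := inverse f13_0.
  (* Replacing e2 by e2 - (f12 / f13) e3 makes it orthogonal to e1. *)
  apply: listed_iso (ltab_isotropic
    (f22 - (1 + 1) * f12 * g * f23 + f12 * f12 * g * g * f33)
    (f23 - f12 * g * f33) f33 f13_0).
  tab 1 0 0 0 1 (- f12 * g) 0 0 1 1;
    try ring; fnsatz.
have [->|f12_0] := eqVneq f12 0; last first.
  move=> _; apply: listed_iso (ltab_isotropic f33 f23 f22 f12_0).
  tab 1 0 0 0 0 1 0 1 0 (-1);
    try ring; fnsatz.
have [x1 [y1 [x2 [y2 [d [D F]]]]]] := binary_form f22 f23 f33.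
case: F; rewrite /form => -[F1 F2 F3].
- have f22_0 : f22 = 0 by fnsatz.
  have f23_0 : f23 = 0 by fnsatz.
  have f33_0 : f33 = 0 by fnsatz.
  rewrite f22_0 f23_0 f33_0 => -[x [y]] /=.
  rewrite [x]vec_eta [y]vec_eta table_mul_vec /= !mulr0 !addr0 => /eqP[].
  by rewrite -vec0.
- move=> _; apply: (@listedM _ _ (M01 K)).
  tab 0 x2 y2 1 0 0 0 x1 y1 d;
    try ring; fnsatz.
- move=> _; apply: (@listedM _ _ (M02 K)).
  tab 0 x1 y1 0 x2 y2 1 0 0 d;
    try ring; fnsatz.
Qed.

End LineTables.

                                       

(** * Normal forms for each type of plane *)

Section TypesListed.
Variable K : numClosedFieldType.

Lemma cube_root (x : K) : exists y, y * y * y = x.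
Proof. by exists (3.-root x); rewrite -[RHS](@rootCK _ 3) // !exprS expr0 mulr1 mulrA. Qed.

(** Since e1 is the unit of the plane, subtracting e1e3 from e3 achieves e1e3 = 0. The cases then
    depend on which coefficients of e2e3 and e3e3 vanish, the others being scaled away by roots. *)
Lemma local_listed (a1 a2 p0 q0 u0 v0 : K) :
  listed (btab 1 0 0 1 0 0 a1 a2 p0 q0 u0 v0).
Proof.
apply: (@listed_iso K _ (btab 1 0 0 1 0 0 0 0 p0 (q0 - a1)
  (u0 - a1 * a1 - (a2 * p0 + a2 * p0)) (v0 - (a2 * q0 + a2 * q0)))).
  by tab 1 0 0 0 1 0 (- a1) (- a2) 1 1; ring.
move: (q0 - a1) (u0 - _ - _) (v0 - _) => q u v; move: p0 => p.
have [->|q_neq0] := eqVneq q 0; last first.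
  have [qi qK] := inverse q_neq0.
  have [->|v_neq0] := eqVneq v 0.
    have [->|p_neq0] := eqVneq p 0.
      apply: (@listedA _ _ (A14 (qi * qi * u + 1))).
      (* Taking e1 - e3 / q as new e3 removes the e2 component of e2e3 at the price of e1e3 = e1. *)
      by tab 1 0 0 0 1 0 1 0 (- qi) (- q); try ring; fnsatz.
    have [pi pK] := inverse p_neq0.
    apply: (@listedA _ _ (A13 (qi * qi * u + 1))).
    by tab 1 0 0 0 (- q * pi) 0 1 0 (- qi) p; try ring; fnsatz.
  have [vi vK] := inverse v_neq0.
  apply: (@listedA _ _ (A12 (- qi * qi * qi * v * p) (qi * qi * u + 1))).
  by tab 1 0 0 0 (qi * qi * v) 0 1 0 (- qi) (- q * q * q * vi);
    try ring; fnsatz.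
have [->|u_neq0] := eqVneq u 0; last first.
  have [c cK] := square_root u^-1; have [ci cK'] := square_root u.
  have uK := divff u_neq0.
  have ccK : c * c * u = 1 by rewrite cK mulVf.
  have [->|p_neq0] := eqVneq p 0.
    have [->|v_neq0] := eqVneq v 0.
      apply: (@listedA _ _ (A17 K)).
      by tab 1 0 0 0 1 0 0 0 c (c * u); clear cK cK' uK; try ring; fnsatz.
    have [vi vK] := inverse v_neq0.
    apply: (@listedA _ _ (A16 K)).
    by tab 1 0 0 0 (c * c * v) 0 0 0 c (c * u * u * vi); clear cK cK' uK;
      try ring; fnsatz.
  have [pi pK] := inverse p_neq0.
  apply: (@listedA _ _ (A15 (c * c * c * p * v))).
  by tab 1 0 0 0 (c * u * pi) 0 0 0 c p; clear cK cK' uK; try ring; fnsatz.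
have [->|p_neq0] := eqVneq p 0; have [->|v_neq0] := eqVneq v 0.
- apply: (@listedJ _ _ J02).
  by tab 1 0 0 0 1 0 0 0 1 1; ring.
- have [vi vK] := inverse v_neq0.
  apply: (@listedA _ _ (A20 K)).
  by tab 1 0 0 0 v 0 0 0 1 vi; try ring; fnsatz.
- have [pi pK] := inverse p_neq0.
  apply: (@listedA _ _ (A19 K)).
  by tab 1 0 0 0 pi 0 0 0 1 p; try ring; fnsatz.
- have [pi pK] := inverse p_neq0; have [vi vK] := inverse v_neq0.
  have [c cK] := cube_root (pi * vi).
  apply: (@listedA _ _ (A18 K)).
  by tab 1 0 0 0 (c * c * v) 0 0 0 c p; try ring; fnsatz.
Qed.

(** Shifting e3 along e1 clears the e1 component of e1e3. A shift along e2 then clears the e2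
    component of e3e3 if q is nonzero, or its e1 component if q = 0 and p is nonzero. *)
Lemma half_listed (a1 a p q u0 v0 : K) :
  listed (btab 1 0 0 0 0 0 a1 a p q u0 v0).
Proof.
apply: (@listed_iso K _ (btab 1 0 0 0 0 0 0 a p q
  (u0 - a1 * a1) (v0 - (a1 * a + a1 * a)))).
  by tab 1 0 0 0 1 0 (- a1) 0 1 1; ring.
move: (u0 - _) (v0 - _) => u v.
have [h hK] := half_exists K.
have e11_neq0 (b c d f g : K) :
    listed (ltab 1 b c d f g) by apply: ltab_idempotent; exact: oner_neq0.
have [->|q_neq0] := eqVneq q 0; last first.
  have [qi qK] := inverse q_neq0.
  pose b := - h * qi * qi * v; pose u' := qi * qi * u + (qi * b * p + qi * b * p).
  have [->|a_neq0] := eqVneq a 0.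
    have [p_0|p_neq0] := eqVneq p 0.
      apply: (@listedA _ _ (A03 u')).
      by rewrite /u' /b p_0; tab 1 0 0 0 1 0 0 (- h * qi * qi * v) qi q; try ring; fnsatz.
    have [pi pK] := inverse p_neq0.
    apply: (@listedA _ _ (A04 u')); rewrite /u' /b.
    by tab 1 0 0 0 (q * pi) 0 0 (- h * qi * qi * v) qi p; try ring; fnsatz.
  have [ai aK] := inverse a_neq0.
  apply: (@listedA _ _ (A05 (qi * a * qi * p) u')); rewrite /u' /b.
  by tab 1 0 0 0 (qi * a) 0 0 (- h * qi * qi * v) qi (ai * q * q); try ring; fnsatz.
have [->|p_neq0] := eqVneq p 0; last first.
  have [pi pK] := inverse p_neq0.
  have [->|a_neq0] := eqVneq a 0; last first.
    have [ai aK] := inverse a_neq0.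
    have [c cK] := square_root (ai * pi).
    apply: (@listedA _ _ (A06 (c * v * ai))).
    by tab 1 0 0 0 (c * a) 0 0 (- h * c * u * pi) c p; try ring; fnsatz.
  have [->|v_neq0] := eqVneq v 0; first exact: e11_neq0.
  have [vi vK] := inverse v_neq0.
  have [c cK] := cube_root (pi * vi).
  apply: (@listedA _ _ (A10 K)).
  by tab 1 0 0 0 (c * c * v) 0 0 (- h * c * u * pi) c p; try ring; fnsatz.
have [->|u_neq0] := eqVneq u 0; have [->|a_neq0] := eqVneq a 0.
- have [->|v_neq0] := eqVneq v 0; first exact: e11_neq0.
  have [vi vK] := inverse v_neq0.
  apply: (@listedJ _ _ J11).
  by tab 1 0 0 0 0 1 0 v 0 (- vi); try ring; fnsatz.
- have [ai aK] := inverse a_neq0.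
  have [->|v_neq0] := eqVneq v 0.
    apply: (@listedA _ _ (A07 K)).
    by tab 1 0 0 0 a 0 0 0 1 ai; try ring; fnsatz.
  have [vi vK] := inverse v_neq0.
  apply: (@listedA _ _ (A08 K)).
  by tab 1 0 0 0 (a * a * vi) 0 0 0 (a * vi) (v * v * ai * ai * ai); try ring; fnsatz.
- have [->|v_neq0] := eqVneq v 0; first exact: e11_neq0.
  have [vi vK] := inverse v_neq0; have [ui uK] := inverse u_neq0.
  have [c cK] := square_root ui.
  apply: (@listedA _ _ (A11 K)).
  by tab 1 0 0 0 (c * c * v) 0 0 0 c (c * u * u * vi); try ring; fnsatz.
- have [ai aK] := inverse a_neq0; have [ui uK] := inverse u_neq0.
  have [c cK] := square_root ui.
  apply: (@listedA _ _ (A09 (c * v * ai))).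
  by tab 1 0 0 0 (c * a) 0 0 0 c (ai * u); try ring; fnsatz.
Qed.

(** Shifting e3 by multiples of the two idempotents leaves only the cross terms of e1e3 and e2e3.
    Exchanging the idempotents reduces to u nonzero, or to a nonzero. *)
Lemma split_listed (a1 a p q u0 v0 : K) :
  listed (btab 1 0 0 0 0 1 a1 a p q u0 v0).
Proof.
apply: (@listed_iso K _ (btab 1 0 0 0 0 1 0 a p 0
  (u0 - a1 * a1 - (q * p + q * p)) (v0 - q * q - (a1 * a + a1 * a)))).
  by tab 1 0 0 0 1 0 (- a1) (- q) 1 1; ring.
move: (u0 - _ - _) (v0 - _ - _) => u v.
have [->|u_neq0] := eqVneq u 0; last first.
  have [ui uK] := inverse u_neq0; have [c cK] := square_root ui.
  apply: (@listedA _ _ (A01 (c * a) (c * p) (c * c * v))).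
  by tab 1 0 0 0 1 0 0 0 c (c * u); try ring; fnsatz.
have [->|v_neq0] := eqVneq v 0; last first.
  have [vi vK] := inverse v_neq0; have [c cK] := square_root vi.
  apply: (@listedA _ _ (A01 (c * p) (c * a) 0)).
  by tab 0 1 0 1 0 0 0 0 c (- c * v); try ring; fnsatz.
have [->|a_neq0] := eqVneq a 0; last first.
  have [ai aK] := inverse a_neq0.
  apply: (@listedA _ _ (A02 (ai * p))).
  by tab 1 0 0 0 1 0 0 0 ai a; try ring; fnsatz.
have [->|p_neq0] := eqVneq p 0; last first.
  have [pi pK] := inverse p_neq0.
  apply: (@listedA _ _ (A02 0)).
  by tab 0 1 0 1 0 0 0 0 pi (- p); try ring; fnsatz.
apply: (@listedJ _ _ J01).
by tab 1 0 0 0 1 0 0 0 1 1; ring.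
Qed.

(** Multiplication by e3 on the plane has trace q + a, and shifting e3 inside the plane preserves
    it. When it is nonzero it can be scaled to 1. *)
Lemma nil_listed_trace (a p q u v : K) : p != 0 -> q + a != 0 ->
  listed (btab 0 1 0 0 0 0 a 0 p q u v).
Proof.
move=> p_neq0 t_neq0; have [h hK] := half_exists K.
have [pi pK] := inverse p_neq0; have [c cK] := inverse t_neq0.
(* r and x clear e1e3, s normalises e2e3 to e1 + e2, y clears the e1 component of e3e3, and w is
   what remains there along the old e2. *)
pose s := (q + a) * pi; pose r := - s * a * pi; pose x := c * a * q * pi.
pose y := - h * (c * u + (x * a + x * a)) * pi.
pose w := c * c * v + x * x + (c * y * q + c * y * q).
apply: (@listedA _ _ (A21 (w * c * c * p * p))).
have sK : s * c * p = 1 by rewrite /s; fnsatz.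
have rE : r * p = - s * a by rewrite /r; fnsatz.
have xE : x * p = c * a * q by rewrite /x; fnsatz.
have yE : y * p = - h * (c * u + (x * a + x * a)) by rewrite /y; fnsatz.
have wE : w = c * c * v + x * x + (c * y * q + c * y * q) by [].
move: s r x y w sK rE xE yE wE => s r x y w sK rE xE yE wE.
by tab s r 0 0 (s * s) 0 x y c (p * p * p * c * c); try ring; fnsatz.
Qed.

Lemma nil_listed_nilpotent (a p u v : K) : p != 0 ->
  listed (btab 0 1 0 0 0 0 a 0 p (- a) u v).
Proof.
move=> p_neq0; have [h hK] := half_exists K.
have [pi pK] := inverse p_neq0.
pose x := - a * a * pi; pose y := - h * (u + (x * a + x * a)) * pi.
have xE : x * p = - a * a by rewrite /x; fnsatz.
have yE : y * p = - h * (u + (x * a + x * a)) by rewrite /y; fnsatz.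
(* With trace 0 the scale c of e3 stays free: the remaining coefficient of e3e3 becomes c^4 p^2 w,
   so it is 0 or can be made 1. *)
have [c [ci [cK cV]]] : exists c ci, c * ci = 1 /\
  let w := v + x * x - (y * a + y * a) in w = 0 \/ c * c * c * c * p * p * w = 1.
  have [w0|w_neq0] := eqVneq (v + x * x - (y * a + y * a)) 0.
    by exists 1, 1; split; [ring|left].
  have [wi wK] := inverse w_neq0.
  have [c1 c1K] := square_root (pi * pi * wi); have [c cK] := square_root c1.
  exists c, (c * c * c * p * p * (v + x * x - (y * a + y * a))).
  by split; [fnsatz|right; fnsatz].
pose s := ci * pi; pose r := - s * a * pi.
have sK : s * c * p = 1 by rewrite /s; fnsatz.
have rE : r * p = - s * a by rewrite /r; fnsatz.
move: {xE yE} x y xE yE s r sK rE cV => x y xE yE s r sK rE cV.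
case: cV => /= wK.
- apply: (@listedA _ _ (A22 K)).
  by tab s r 0 0 (s * s) 0 (c * x) (c * y) c (p * p * p * c * c); try ring; fnsatz.
- apply: (@listedA _ _ (A23 K)).
  by tab s r 0 0 (s * s) 0 (c * x) (c * y) c (p * p * p * c * c); try ring; fnsatz.
Qed.

(** The shift x e1 of e3 that clears the e1 component of e3e3 spoils e1e3 by x e2; distinct
    eigenvalues a and q let r diagonalise again. *)
Lemma nil_listed_semisimple (a q u v : K) : a != 0 -> q != a ->
  listed (btab 0 1 0 0 0 0 a 0 0 q u v).
Proof.
move=> a_neq0 qa_neq0; have [h hK] := half_exists K.
have [c cK] := inverse a_neq0.
have qa : a - q != 0 by rewrite subr_eq0 eq_sym.
have [m mK] := inverse qa.
pose x := - h * c * c * u; pose r := x * a * m.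
have xE : x + x = - c * c * u by rewrite /x; fnsatz.
have rE : r * (a - q) = x * a by rewrite /r; fnsatz.
move: {mK m qa qa_neq0} x r xE rE => x r xE rE.
have [q_0|q_neq0] := eqVneq q 0; last first.
  have [qi qK] := inverse q_neq0.
  pose y := - h * (c * c * v + x * x) * a * qi.
  have yE : y * q = - h * (c * c * v + x * x) * a by rewrite /y; fnsatz.
  move: y yE => y yE.
  apply: (@listedA _ _ (A24 (c * q))).
  by tab 1 r 0 0 1 0 x y c a; try ring; fnsatz.
have [w0|w_neq0] := eqVneq (c * c * v + x * x) 0.
  apply: (@listedA _ _ (A24 0)).
  by tab 1 r 0 0 1 0 x 0 c a; try ring; fnsatz.
have [w wK] := inverse w_neq0; have [s sK] := square_root (c * c * v + x * x).
apply: (@listedA _ _ (A25 K)).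
by tab s (s * r) 0 0 (s * s) 0 x 0 c (s * w * w * a); try ring; fnsatz.
Qed.

(** With equal eigenvalues the off-diagonal term created by the shift x e1 cannot be diagonalised
    away. If nonzero it is scaled to 1, which gives [A26]. *)
Lemma nil_listed_scalar (a u v : K) : a != 0 ->
  listed (btab 0 1 0 0 0 0 a 0 0 a u v).
Proof.
move=> a_neq0; have [h hK] := half_exists K.
have [c cK] := inverse a_neq0.
have [->|u_neq0] := eqVneq u 0.
  apply: (@listedA _ _ (A24 1)).
  by tab 1 0 0 0 1 0 0 (- h * c * c * v) c a; try ring; fnsatz.
have [ui uK] := inverse u_neq0.
pose x := - h * c * c * u; pose xi := - (1 + 1) * a * a * ui.
have xK : x * xi = 1 by rewrite /x /xi; fnsatz.
have xE : x + x = - c * c * u by rewrite /x; fnsatz.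
move: x xi xK xE => x xi xK xE.
apply: (@listedA _ _ (A26 K)).
by tab x 0 0 0 (x * x) 0 x (- h * (c * c * v + x * x)) c (a * xi * xi * xi);
  try ring; fnsatz.
Qed.

Lemma nil_listed_zero (q u v : K) : listed (btab 0 1 0 0 0 0 0 0 0 q u v).
Proof.
have [h hK] := half_exists K.
have [->|u_neq0] := eqVneq u 0.
  (* With a = p = u = 0 all products are multiples of e2, so the square is a line. *)
  apply: (@listed_iso K _ (ltab 0 0 q 1 0 v)).
    by tab 0 1 0 1 0 0 0 0 1 (-1); ring.
  apply: ltab_listed; exists (vec 0 1 0), (vec 0 1 0) => /=.
  rewrite table_mul_vec (@vec0 K); apply/eqP => /vec_inj[] /=.
  by rewrite !(mulr0, mul0r, add0r, addr0, mulr1) => /eqP; rewrite oner_eq0.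
have [ui uK] := inverse u_neq0.
have [->|q_neq0] := eqVneq q 0.
  apply: (@listedA _ _ (A27 K)).
  by tab u v 0 0 (u * u) 0 0 0 1 (ui * ui * ui); try ring; fnsatz.
have [c cK] := inverse q_neq0.
apply: (@listedA _ _ (A28 K)).
by tab (c * c * u) 0 0 0 (c * c * c * c * u * u) 0 0 (- h * c * c * v) c
  (q * q * q * q * q * q * q * ui * ui * ui); try ring; fnsatz.
Qed.

Lemma nil_listed (a b p q u0 v0 : K) :
  listed (btab 0 1 0 0 0 0 a b p q u0 v0).
Proof.
apply: (@listed_iso K _ (btab 0 1 0 0 0 0 a 0 p q
  (u0 - (b * a + b * a)) (v0 - b * b))).
  by tab 1 0 0 0 1 0 (- b) 0 1 1; ring.
move: (u0 - _) (v0 - _) => u v.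
have [->|p_neq0] := eqVneq p 0; last first.
  have [t0|t_neq0] := eqVneq (q + a) 0; last exact: nil_listed_trace.
  have -> : q = - a by fnsatz.
  exact: nil_listed_nilpotent.
have [->|a_neq0] := eqVneq a 0; first exact: nil_listed_zero.
have [->|qa] := eqVneq q a; first exact: nil_listed_scalar.
exact: nil_listed_semisimple.
Qed.

Lemma null_listed_diagonal (a q u v : K) : a != 0 ->
  listed (btab 0 0 0 0 0 0 a 0 0 q u v).
Proof.
move=> a_neq0; have [h hK] := half_exists K.
have [c cK] := inverse a_neq0.
have [->|q_neq0] := eqVneq q 0; last first.
  have [qi qK] := inverse q_neq0.
  apply: (@listedM _ _ (M04 (c * q))).
  by tab 1 0 0 0 1 0 (- h * c * c * u) (- h * c * v * qi) c a; try ring; fnsatz.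
have [->|v_neq0] := eqVneq v 0.
  apply: (@listedM _ _ (M04 0)).
  by tab 1 0 0 0 1 0 (- h * c * c * u) 0 c a; try ring; fnsatz.
have [vi vK] := inverse v_neq0.
apply: (@listedM _ _ (M05 K)).
by tab 1 0 0 0 (c * c * v) 0 (- h * c * c * u) 0 c (a * a * a * vi);
  try ring; fnsatz.
Qed.

(** The plane has zero product, so only the operator of multiplication by e3 and the vector e3e3
    matter: diagonalise if q differs from a, otherwise reach a Jordan block or a scalar. *)
Lemma null_listed_triangular (a p q u v : K) :
  nontrivial (btab 0 0 0 0 0 0 a 0 p q u v) ->
  listed (btab 0 0 0 0 0 0 a 0 p q u v).
Proof.
have [h hK] := half_exists K.
have [->|qa] := eqVneq q a; last first.
  have qa' : q - a != 0 by rewrite subr_eq0.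
  have [m mK] := inverse qa'.
  move=> _; apply: (@listed_iso K _
      (btab 0 0 0 0 0 0 a 0 0 q (u - v * p * m) v)).
    by tab 1 0 0 (p * m) 1 0 0 0 1 1; try ring; fnsatz.
  have [a0|a_neq0] := eqVneq a 0; last exact: null_listed_diagonal.
  have q_neq0 : q != 0 by rewrite -a0.
  move: (u - _) => u'; apply: listed_iso (null_listed_diagonal a v u' q_neq0).
  by tab 0 1 0 1 0 0 0 0 1 (-1); ring.
have [->|p_neq0] := eqVneq p 0.
  have [->|a_neq0] := eqVneq a 0; last by move=> _; exact: null_listed_diagonal.
  have [->|v_neq0] := eqVneq v 0; first exact: ltab_listed.
  have [vi vK] := inverse v_neq0.
  move=> _; apply: (@listedM _ _ (M01 K)).
  by tab 0 0 1 u v 0 1 0 0 (- vi); try ring; fnsatz.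
have [pi pK] := inverse p_neq0.
have [->|a_neq0] := eqVneq a 0.
  have [->|v_neq0] := eqVneq v 0; first exact: ltab_listed.
  have [vi vK] := inverse v_neq0.
  move=> _; apply: (@listedM _ _ (M03 K)).
  by tab 0 0 1 u v 0 (v * p) 0 0 (- vi * vi * pi); try ring; fnsatz.
have [c cK] := inverse a_neq0.
move=> _; apply: (@listedM _ _ (M06 K)).
by tab 0 1 0 (c * p) 0 0 (- h * c * c * u + h * c * c * c * p * v) (- h * c * c * v) c
  (- pi * a * a); try ring; fnsatz.
Qed.

Lemma null_listed (a1 a2 p q u v : K) :
  nontrivial (btab 0 0 0 0 0 0 a1 a2 p q u v) ->
  listed (btab 0 0 0 0 0 0 a1 a2 p q u v).
Proof.
have [->|a2_neq0] := eqVneq a2 0; first exact: null_listed_triangular.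
have [h hK] := half_exists K.
have [b bK] := inverse a2_neq0.
have [r rK] := square_root ((q - a1) * (q - a1) + (1 + 1) * (1 + 1) * a2 * p).
(* This is the root of the quadratic making (x, 1) an eigenvector of multiplication by e3; taken as
   new e1 it triangularises the operator. *)
pose x := h * b * (a1 - q + r).
have xE : a2 * x * x + (q - a1) * x - p = 0 by rewrite /x; fnsatz.
move: x xE => x xE.
have iso : alg_isomorphic (btab 0 0 0 0 0 0 a1 a2 p q u v)
    (btab 0 0 0 0 0 0 (x * a2 + q) 0 a2 (a1 - a2 * x) v (u - v * x)).
  by tab x 1 0 1 0 0 0 0 1 (-1); try ring; fnsatz.
move=> nt; apply: (listed_iso iso); apply: null_listed_triangular.
exact: (nontrivial_iso iso).
Qed.

End TypesListed.

(** * Reducing the associative plane to one of the types *)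

Section BlockClassification.
Variable K : numClosedFieldType.

(** Only the basis of the plane changes; Cramer's rule with m, the inverse determinant, expresses
    the products with e3 in it. *)
Lemma block_basis (b1 b2 c1 c2 d1 d2 a1 a2 p1 p2 w1 w2
    b1' b2' c1' c2' d1' d2' x1 x2 y1 y2 m : K) :
  (x1 * y2 - x2 * y1) * m = 1 ->
  bprod b1 c1 d1 x1 x2 x1 x2 = b1' * x1 + b2' * y1 ->
  bprod b2 c2 d2 x1 x2 x1 x2 = b1' * x2 + b2' * y2 ->
  bprod b1 c1 d1 x1 x2 y1 y2 = c1' * x1 + c2' * y1 ->
  bprod b2 c2 d2 x1 x2 y1 y2 = c1' * x2 + c2' * y2 ->
  bprod b1 c1 d1 y1 y2 y1 y2 = d1' * x1 + d2' * y1 ->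
  bprod b2 c2 d2 y1 y2 y1 y2 = d1' * x2 + d2' * y2 ->
  exists a1' a2' p1' p2' w1' w2',
    alg_isomorphic (btab b1 b2 c1 c2 d1 d2 a1 a2 p1 p2 w1 w2)
      (btab b1' b2' c1' c2' d1' d2' a1' a2' p1' p2' w1' w2').
Proof.
move=> mK E1 E2 E3 E4 E5 E6.
exists (m * ((x1 * a1 + x2 * p1) * y2 - (x1 * a2 + x2 * p2) * y1)).
exists (m * ((x1 * a2 + x2 * p2) * x1 - (x1 * a1 + x2 * p1) * x2)).
exists (m * ((y1 * a1 + y2 * p1) * y2 - (y1 * a2 + y2 * p2) * y1)).
exists (m * ((y1 * a2 + y2 * p2) * x1 - (y1 * a1 + y2 * p1) * x2)).
exists (m * (w1 * y2 - w2 * y1)), (m * (w2 * x1 - w1 * x2)).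
apply: (block_iso (x1 := x1) (x2 := x2) (y1 := y1) (y2 := y2)
  (z1 := 0) (z2 := 0) (k := 1)).
split; first split; last 1 first.
- split; first by split.
  rewrite /bprod.
  have solve (g1 g2 : K) :
      g1 = m * (g1 * y2 - g2 * y1) * x1 + m * (g2 * x1 - g1 * x2) * y1 /\
      g2 = m * (g1 * y2 - g2 * y1) * x2 + m * (g2 * x1 - g1 * x2) * y2.
    by clear E1 E2 E3 E4 E5 E6; split; fnsatz.
  have [A1 A2] := solve (x1 * a1 + x2 * p1) (x1 * a2 + x2 * p2).
  have [P1 P2] := solve (y1 * a1 + y2 * p1) (y1 * a2 + y2 * p2).
  have [W1 W2] := solve w1 w2.
  split; split => //.
  + by rewrite -[RHS]A1; ring.
  + by rewrite -[RHS]A2; ring.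
  + by rewrite -[RHS]P1; ring.
  + by rewrite -[RHS]P2; ring.
  + by rewrite -[RHS]W1; ring.
  + by rewrite -[RHS]W2; ring.
- by apply/eqP => D0; move/eqP: mK; rewrite D0 mul0r eq_sym oner_eq0.
- exact: oner_neq0.
Qed.

                                                                        
(** Coordinates of (e1e1)e2 = e1(e1e2) and (e1e2)e2 = e1(e2e2). *)
Definition bassoc (b1 b2 c1 c2 d1 d2 : K) :=
  [/\ b1 * c1 + b2 * d1 = c1 * b1 + c2 * c1,
      b1 * c2 + b2 * d2 = c1 * b2 + c2 * c2,
      c1 * c1 + c2 * d1 = d1 * b1 + d2 * c1 &
      c1 * c2 + c2 * d2 = d1 * b2 + d2 * c2].

                                                             
(** The plane has basis g, g^2 with g(g - r)(g - s) = 0. The nil, half, local and split types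
    correspond to r = s = 0, exactly one zero root, a nonzero double root, and distinct nonzero
    roots. *)
Lemma monogenic_listed (r s a1 a2 p1 p2 w1 w2 : K) :
  listed (btab 0 1 (- r * s) (r + s) (- r * s * (r + s))
    ((r + s) * (r + s) - r * s) a1 a2 p1 p2 w1 w2).
Proof.
have half_case (t : K) (u1 u2 v1 v2 q1 q2 : K) : t != 0 ->
    listed (btab 0 1 0 t 0 (t * t) u1 u2 v1 v2 q1 q2).
  move=> t0; have [i tK] := inverse t0.
  have [] := block_basis u1 u2 v1 v2 q1 q2 (b1 := 0) (b2 := 1) (c1 := 0)
    (c2 := t) (d1 := 0) (d2 := t * t) (b1' := 1) (b2' := 0) (c1' := 0)
    (c2' := 0) (d1' := 0) (d2' := 0) (x1 := 0) (x2 := i * i) (y1 := 1)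
    (y2 := - i) (m := - t * t);
  rewrite /bprod; try ring; try fnsatz.
  move=> ? [? [? [? [? [? iso]]]]]; apply: (listed_iso iso).
  exact: half_listed.
have [->|r_neq0] := eqVneq r 0; have [->|s_neq0] := eqVneq s 0.
- rewrite !(oppr0, mul0r, addr0, subr0); exact: nil_listed.
- rewrite !(oppr0, mul0r, add0r, subr0); exact: half_case.
- rewrite !(mulr0, mul0r, addr0, subr0); exact: half_case.
have [ri rK] := inverse r_neq0; have [si sK] := inverse s_neq0.
have [<-|rs_neq] := eqVneq r s.
  (* The unit is 1 - (1 - g/r)^2 and the nilpotent is g(g - r)/r. *)
  have [] := block_basis a1 a2 p1 p2 w1 w2 (b1 := 0) (b2 := 1)
    (c1 := - r * r) (c2 := r + r) (d1 := - r * r * (r + r))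
    (d2 := (r + r) * (r + r) - r * r) (b1' := 1) (b2' := 0) (c1' := 0)
    (c2' := 1) (d1' := 0) (d2' := 0) (x1 := ri + ri) (x2 := - ri * ri)
    (y1 := - 1) (y2 := ri) (m := r * r);
  rewrite /bprod; try ring; try fnsatz.
  move=> ? [? [? [? [? [? iso]]]]]; apply: (listed_iso iso).
  exact: local_listed.
have rs0 : r - s != 0 by rewrite subr_eq0.
have [i iK] := inverse rs0.
(* The idempotents are the Lagrange interpolants g(g - s)/(r(r - s)) and g(g - r)/(s(s - r)). *)
have [] := block_basis a1 a2 p1 p2 w1 w2 (b1 := 0) (b2 := 1)
  (c1 := - r * s) (c2 := r + s) (d1 := - r * s * (r + s))
  (d2 := (r + s) * (r + s) - r * s) (b1' := 1) (b2' := 0) (c1' := 0)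
  (c2' := 0) (d1' := 0) (d2' := 1) (x1 := - s * ri * i) (x2 := ri * i)
  (y1 := r * si * i) (y2 := - si * i) (m := - r * s * (r - s));
rewrite /bprod; try ring; try fnsatz.
move=> ? [? [? [? [? [? iso]]]]]; apply: (listed_iso iso).
exact: split_listed.
Qed.

Lemma block_listed_generator (b1 b2 c1 c2 d1 d2 a1 a2 p1 p2 w1 w2 : K) :
  bassoc b1 b2 c1 c2 d1 d2 -> b2 != 0 ->
  listed (btab b1 b2 c1 c2 d1 d2 a1 a2 p1 p2 w1 w2).
Proof.
case=> A1 A2 A3 A4 b0; have [i iK] := inverse b0; have [h hK] := half_exists K.
(* r and s are the roots of the characteristic polynomial of multiplication by e1 on the plane,
   which has e1, e1e1 as a basis. *)
have [q qK] := square_root ((b1 + c2) * (b1 + c2)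
   + (1 + 1) * (1 + 1) * (b2 * c1 - b1 * c2)).
pose r := h * (b1 + c2 + q); pose s := h * (b1 + c2 - q).
have rs : r + s = b1 + c2 by rewrite /r /s; fnsatz.
have rs' : r * s = b1 * c2 - b2 * c1 by rewrite /r /s; fnsatz.
move: r s rs rs' => r s rs rs'; clear h hK q qK.
have [] := block_basis a1 a2 p1 p2 w1 w2 (b1 := b1) (b2 := b2)
  (c1 := c1) (c2 := c2) (d1 := d1) (d2 := d2) (b1' := 0) (b2' := 1)
  (c1' := - r * s) (c2' := r + s) (d1' := - r * s * (r + s))
  (d2' := (r + s) * (r + s) - r * s)
  (x1 := 1) (x2 := 0) (y1 := b1) (y2 := b2) (m := i);
rewrite /bprod; try ring; try fnsatz.
move=> ? [? [? [? [? [? iso]]]]]; apply: (listed_iso iso).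
exact: monogenic_listed.
Qed.

                                                                             
                                
(** It suffices that one of e1, e2, e1 + e2, e1 - e2 is not proportional to its square. If all four
    are, associativity makes the product on the plane zero. *)
Lemma block_listed (b1 b2 c1 c2 d1 d2 a1 a2 p1 p2 w1 w2 : K) :
  bassoc b1 b2 c1 c2 d1 d2 ->
  nontrivial (btab b1 b2 c1 c2 d1 d2 a1 a2 p1 p2 w1 w2) ->
  listed (btab b1 b2 c1 c2 d1 d2 a1 a2 p1 p2 w1 w2).
Proof.
have [b0|b0] := eqVneq b2 0; last by move=> *; exact: block_listed_generator.
have [d0|d0] := eqVneq d1 0; last first.
  move=> [A1 A2 A3 A4] _.
  apply: (@listed_iso K _ (btab d2 d1 c2 c1 b2 b1 p2 p1 a2 a1 w2 w1)).
    by tab 0 1 0 1 0 0 0 0 1 (-1); ring.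
  by apply: block_listed_generator => //; split; fnsatz.
subst b2 d1; case=> A1 A2 A3 A4.
have [E1|N1] := eqVneq (d2 + c2 + c2 - b1 - c1 - c1) 0; last first.
  move=> _; have [] := block_basis a1 a2 p1 p2 w1 w2 (b1 := b1) (b2 := 0)
    (c1 := c1) (c2 := c2) (d1 := 0) (d2 := d2) (b1' := b1 + c1 + c1)
    (b2' := d2 + c2 + c2 - b1 - c1 - c1)
    (c1' := c1) (c2' := c2 + d2 - c1) (d1' := 0) (d2' := d2)
    (x1 := 1) (x2 := 1) (y1 := 0) (y2 := 1) (m := 1);
  rewrite /bprod; try ring.
  move=> ? [? [? [? [? [? iso]]]]]; apply: (listed_iso iso).
  by apply: block_listed_generator => //; clear iso N1; split; fnsatz.
have [E2|N2] := eqVneq (d2 - c2 - c2 + b1 - c1 - c1) 0; last first.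
  move=> _; have [] := block_basis a1 a2 p1 p2 w1 w2 (b1 := b1) (b2 := 0)
    (c1 := c1) (c2 := c2) (d1 := 0) (d2 := d2) (b1' := b1 - c1 - c1)
    (b2' := d2 - c2 - c2 + b1 - c1 - c1)
    (c1' := c1) (c2' := c2 - d2 + c1) (d1' := 0) (d2' := d2)
    (x1 := 1) (x2 := - 1) (y1 := 0) (y2 := 1) (m := 1);
  rewrite /bprod; try ring.
  move=> ? [? [? [? [? [? iso]]]]]; apply: (listed_iso iso).
  by apply: block_listed_generator => //; clear iso N2; split; fnsatz.
have -> : b1 = 0 by fnsatz.
have -> : c1 = 0 by fnsatz.
have -> : c2 = 0 by fnsatz.
have -> : d2 = 0 by fnsatz.
exact: null_listed.
Qed.

End BlockClassification.

                                                   

(** * Unital commutative associative algebras of dimension 3 *)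

Section UnitalTables.
Variable K : numClosedFieldType.

                                                                               
(** This is C[X] modulo (X - r)(X - s)(X - t) in the basis 1, X, X^2. *)
Definition cubic_tab (r s t : K) : algebra K :=
  let a := r + s + t in let b := - (r * s + s * t + t * r) in
  let c := r * s * t in
  table (vec 1 0 0) (vec 0 1 0) (vec 0 0 1) (vec 0 0 1) (vec c b a)
    (vec (a * c) (c + a * b) (b + a * a)).

Lemma cubic_tabC r s t : cubic_tab r s t = cubic_tab s t r.
Proof. by apply: table_eq; apply: vec_eq; ring. Qed.

Lemma cubic_roots (a b c : K) : exists r s t : K,
  [/\ r + s + t = a, - (r * s + s * t + t * r) = b & r * s * t = c].
Proof.
have [r rK] : exists r : K, r * r * r = c + b * r + a * r * r.
  have [r] := @solve_monicpoly K 3 (nth 0 [:: c; b; a]) isT.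
  rewrite !big_ord_recl big_ord0 /= => rE.
  by exists r; transitivity (r ^+ 3); [ring|rewrite rE; ring].
have [h hK] := half_exists K.
have [q qK] := square_root ((a - r) * (a - r) + (1 + 1) * (1 + 1) * (b + r * (a - r))).
exists r, (h * (a - r + q)), (h * (a - r - q)).
by split; fnsatz.
Qed.

Lemma cubic_tab_double (r t : K) : listed (cubic_tab r r t).
Proof.
rewrite /cubic_tab.
have [->|rt] := eqVneq t r.
  apply: (@listedJ _ _ J10).
  by tab 1 0 0 (- r) 1 0 (r * r) (- r - r) 1 1; ring.
have rt0 : t - r != 0 by rewrite subr_eq0.
have [i iK] := inverse rt0; clear rt rt0.
apply: (@listedJ _ _ J08).
(* The basis is the idempotent (X - r)^2 / (t - r)^2, its complement, and the nilpotent (X - r)(X -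
   t). *)
by tab (r * r * i * i) (- (r + r) * i * i) (i * i)
  (1 - r * r * i * i) ((r + r) * i * i) (- i * i) (r * t) (- (r + t)) 1 (r - t);
  try ring; fnsatz.
Qed.

Lemma cubic_tab_listed (r s t : K) : listed (cubic_tab r s t).
Proof.
have [->|rs] := eqVneq r s; first exact: cubic_tab_double.
have [->|st] := eqVneq s t.
  by rewrite cubic_tabC; exact: cubic_tab_double.
have [->|tr] := eqVneq t r.
  by rewrite cubic_tabC cubic_tabC; exact: cubic_tab_double.
have [i iK] := inverse (x := r - s) ltac:(by rewrite subr_eq0).
have [j jK] := inverse (x := s - t) ltac:(by rewrite subr_eq0).
have [k kK] := inverse (x := t - r) ltac:(by rewrite subr_eq0).
clear rs st tr; apply: (@listedJ _ _ J07); rewrite /cubic_tab.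
(* The three Lagrange idempotents of the distinct roots. *)
by tab (- i * k * s * t) (i * k * (s + t)) (- i * k)
  (- i * j * t * r) (i * j * (t + r)) (- i * j)
  (- j * k * r * s) (j * k * (r + s)) (- j * k)
  ((r - s) * (s - t) * (t - r)); try ring; fnsatz.
Qed.

Definition unital_tab (a1 a2 a3 b1 b2 b3 c1 c2 c3 : K) : algebra K :=
  table (vec 1 0 0) (vec 0 1 0) (vec 0 0 1) (vec a1 a2 a3) (vec b1 b2 b3)
    (vec c1 c2 c3).

                                                                        
Definition unital_assoc (a1 a2 a3 b1 b2 b3 c1 c2 c3 : K) :=
  [/\ a2 * b1 + a3 * c1 = b2 * a1 + b3 * b1,
      a2 * b2 + a3 * c2 = b1 + b2 * a2 + b3 * b2 &
      a1 + a2 * b3 + a3 * c3 = b2 * a3 + b3 * b3] /\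
  [/\ b2 * b1 + b3 * c1 = c2 * a1 + c3 * b1,
      b2 * b2 + b3 * c2 = c1 + c2 * a2 + c3 * b2 &
      b1 + b2 * b3 + b3 * c3 = c2 * a3 + c3 * b3].

Lemma unital_generator_listed (a1 a2 a3 b1 b2 b3 c1 c2 c3 : K) :
  unital_assoc a1 a2 a3 b1 b2 b3 c1 c2 c3 -> a3 != 0 ->
  listed (unital_tab a1 a2 a3 b1 b2 b3 c1 c2 c3).
Proof.
move=> [[A1 A2 A3] [A4 A5 A6]] a3_neq0; have [i iK] := inverse a3_neq0.
have [r [s [t [R1 R2 R3]]]] := cubic_roots (a2 + b3) (a1 + a3 * b2 - a2 * b3)
  (a3 * b1 - b3 * a1).
apply: listed_iso (cubic_tab_listed r s t).
rewrite /cubic_tab R1 R2 R3 /unital_tab; clear a3_neq0 R1 R2 R3 r s t.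
by tab 1 0 0 0 1 0 a1 a2 a3 i; try ring; fnsatz.
Qed.

(** With basis 1, y, z, one of y, z, y + z, y - z generates the algebra unless the product
    degenerates; then y and z minus suitable multiples of 1 span a plane with zero product. *)
Lemma unital_listed (a1 a2 a3 b1 b2 b3 c1 c2 c3 : K) :
  unital_assoc a1 a2 a3 b1 b2 b3 c1 c2 c3 ->
  listed (unital_tab a1 a2 a3 b1 b2 b3 c1 c2 c3).
Proof.
have [a3_0|a3_neq0] := eqVneq a3 0; last by move=> *; exact: unital_generator_listed.
move=> [[A1 A2 A3] [A4 A5 A6]].
have [c2_0|c2_neq0] := eqVneq c2 0; last first.
  apply: (@listed_iso K _ (unital_tab c1 c3 c2 b1 b3 b2 a1 a3 a2)).
    by rewrite /unital_tab; tab 1 0 0 0 0 1 0 1 0 (-1); ring.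
  apply: unital_generator_listed => //.
  by clear c2_neq0; do !split; fnsatz.
subst a3 c2.
have [E1|N1] := eqVneq (b3 + b3 + c3 - a2 - b2 - b2) 0; last first.
  apply: (@listed_iso K _ (unital_tab (a1 + b1 + b1 + c1) (a2 + b2 + b2)
    (b3 + b3 + c3 - a2 - b2 - b2) (b1 + c1) b2 (b3 + c3 - b2) c1 0 c3)).
    by rewrite /unital_tab; tab 1 0 0 0 1 1 0 0 1 1; ring.
  apply: unital_generator_listed => //.
  by clear N1; do !split; fnsatz.
have [E2|N2] := eqVneq (c3 - b3 - b3 + a2 - b2 - b2) 0; last first.
  apply: (@listed_iso K _ (unital_tab (a1 - b1 - b1 + c1) (a2 - b2 - b2)
    (c3 - b3 - b3 + a2 - b2 - b2) (b1 - c1) b2 (b3 - c3 + b2) c1 0 c3)).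
    by rewrite /unital_tab; tab 1 0 0 0 1 (-1) 0 0 1 1; ring.
  apply: unital_generator_listed => //.
  by clear N2; do !split; fnsatz.
apply: (@listedJ _ _ J09); rewrite /unital_tab.
by tab 1 0 0 (- b3) 1 0 (- b2) 0 1 1; try ring; fnsatz.
Qed.

End UnitalTables.

(** * A commutative associative algebra with A^2 = A has a unit *)

Section AssociativeUnit.
Variables (K : numClosedFieldType) (A : algebra K).
Hypothesis dimA : \dim (fullv : {vspace A}) = 3%N.
Hypothesis mulC : forall x y : A, x ** y = y ** x.
Hypothesis mulA : forall x y z : A, (x ** y) ** z = x ** (y ** z).
Hypothesis mul_span : forall P : A -> Prop,
  (forall k a b, P a -> P b -> P (k *: a + b)) ->
  (forall x y, P (x ** y)) -> forall a, P a.

Lemma amul0l (x : A) : 0 ** x = 0.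
Proof. by have := amulZl 0 (0 : A) x; rewrite !scale0r. Qed.

Lemma amul0r (x : A) : x ** 0 = 0.
Proof. by rewrite mulC amul0l. Qed.

Lemma amul_sumr I (r : seq I) (F : I -> A) (x : A) :
  x ** (\sum_(i <- r) F i) = \sum_(i <- r) x ** F i.
Proof.
by apply: (big_morph _ (fun u v => amulDr u v x)); exact: amul0r.
Qed.

Lemma size_free (s : seq A) : free s -> (size s <= 3)%N.
Proof.
by rewrite -dimA /free => /eqP <-; apply: dimvS; exact: subvf.
Qed.

Lemma free3_span (v1 v2 v3 : A) : free [:: v1; v2; v3] ->
  forall a, exists k1 k2 k3, a = k1 *: v1 + k2 *: v2 + k3 *: v3.
Proof.
move=> vfree a; pose X := [tuple v1; v2; v3].
have X_basis : basis_of fullv X by rewrite basisEfree vfree subvf dimA.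
rewrite (coord_basis X_basis (memvf a)) !big_ord_recl big_ord0 addr0 /= addrA.
by do 3!eexists.
Qed.

(** If x, x^2, x^3 are independent they span A and x divides everything, which yields a unit. A
    dependence yields an idempotent that is a polynomial in x without constant term, hence killed by
    whatever kills x. *)
Lemma idempotent_or_unit (x : A) : x ** (x ** x) != 0 ->
  (exists u : A, forall a, u ** a = a) \/
  exists f : A, [/\ f != 0, f ** f = f & forall e : A, e ** x = 0 -> e ** f = 0].
Proof.
pose xx := x ** x; pose x3 := x ** xx; rewrite -/xx -/x3 => x3_0.
have [xfree|] := boolP (free [:: x; xx; x3]).
  left; have genx : forall a, exists w, a = x ** w.
    apply: mul_span => [k a b [w ->] [w' ->]|a b].
      by exists (k *: w + w'); rewrite amulDr amulZr.
    have [k1 [k2 [k3 ->]]] := free3_span xfree a.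
    exists (k1 *: b + k2 *: (x ** b) + k3 *: (xx ** b)).
    by rewrite !(amulDl, amulDr, amulZl, amulZr) /x3 /xx !mulA.
  have [w xw] := genx x; exists w => a; have [z ->] := genx a.
  by rewrite -mulA (mulC w) -xw.
move=> xnfree; right.
have xE (e : A) : e ** x = x -> e ** xx = xx by move=> ex; rewrite /xx -mulA ex.
have [a [b xab]] : exists a b, x = a *: xx + b *: x3 \/ (xx = a *: x3).
  move: xnfree; rewrite free_cons negb_and negbK => /orP[|].
    rewrite span_cons span_seq1 => /memv_addP[y /vlineP[a ->] [z /vlineP[b ->] ->]].
    by exists a, b; left.
  rewrite free_cons negb_and negbK span_seq1 => /orP[/vlineP[a ->]|].
    by exists a, 0; right.
  by rewrite seq1_free negbK (negbTE x3_0).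
case: xab => [xab|xxa].
(* If x = a x^2 + b x^3, then f = a x + b x^2 fixes x and therefore itself. *)
- have fx : (a *: x + b *: xx) ** x = x.
    by rewrite amulDl !amulZl (mulC xx) -/xx -/x3 -xab.
  exists (a *: x + b *: xx); split.
  + apply: contra_neq x3_0 => f0; move: fx; rewrite f0 amul0l => x0.
    by rewrite /x3 -x0 amul0l.
  + by rewrite [in LHS]amulDr !amulZr fx (xE _ fx).
  + by move=> e ex; rewrite amulDr !amulZr /xx -mulA ex amul0l !scaler0 addr0.
(* If x^2 = a x^3, then g = a x fixes x^2, so g^2 is idempotent. *)
- have fxx : (a *: x) ** xx = xx by rewrite amulZl -/x3 -xxa.
  exists ((a *: x) ** (a *: x)); split.
  + apply: contra_neq x3_0 => f0.
    have : ((a *: x) ** (a *: x)) ** xx = xx by rewrite mulA !fxx.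
    by rewrite f0 amul0l /x3 => <-; rewrite amul0r.
  + have ggE : (a *: x) ** (a *: x) = (a * a) *: xx.
      by rewrite amulZl amulZr scalerA.
    have gg : (a *: x) ** ((a *: x) ** (a *: x)) = (a *: x) ** (a *: x).
      by rewrite ggE amulZr fxx.
    by rewrite [LHS]mulA !gg.
  + by move=> e ex; rewrite -mulA (amulZr a e) ex scaler0 amul0l.
Qed.

                                         
(** Polarisation: the cubes of u + v and u - v give 6 u^2 v = 0, and the square in u^2 w is then
    polarised at u + v to give 2 uvw = 0. *)
Lemma cubes_zero (P : A -> Prop) :
  (forall k a b, P a -> P b -> P (k *: a + b)) ->
  (forall u : A, P u -> u ** (u ** u) = 0) ->
  forall u v w : A, P u -> P v -> P w -> u ** (v ** w) = 0.
Proof.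
move=> Plin P3.
have swap (u v w : A) : v ** (u ** w) = u ** (v ** w).
  by rewrite -!mulA (mulC v).
have uuv (u v : A) : P u -> P v -> u ** (u ** v) = 0.
  move=> Pu Pv; pose a := u ** (u ** v); pose b := u ** (v ** v); rewrite -/a.
  have E k : (k + k + k) *: a + (k * k + k * k + k * k) *: b = 0.
    have Puv : P (k *: v + u) by exact: Plin.
    have := P3 _ Puv; rewrite !(amulDl, amulDr, amulZl, amulZr) !P3 //.
    rewrite !scaler0 add0r addr0 (mulC v u) (swap u v v) (swap u v u) (mulC v u).
    rewrite -/a -/b !scalerDr !scalerA => <-; rewrite !scalerDl.
    by rewrite [RHS](AC (1*2*(2*1)) ((3*5*6)*(1*2*4))).
  have : (1 + 1 + 1 + 1 + 1 + 1) *: a = 0.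
    rewrite -[RHS](subrr 0) -{1}(E 1) -(E (- 1)) !mulrNN !mulr1.
    by rewrite opprD addrACA subrr addr0 -scalerBl !opprD !opprK !addrA.
  have -> : 1 + 1 + 1 + 1 + 1 + 1 = 6%:R :> K by ring.
  by move/eqP; rewrite scaler_eq0 pnatr_eq0 => /eqP.
move=> u v w Pu Pv Pw.
have Puv : P (1 *: u + v) by exact: Plin.
have := uuv _ _ Puv Pw; rewrite scale1r !(amulDl, amulDr) !uuv //.
rewrite add0r addr0 (swap u v w) => /eqP.
by rewrite -mulr2n -scaler_nat scaler_eq0 pnatr_eq0 => /eqP.
Qed.

                                                                                 
                                            
(** Enlarge an idempotent e by orthogonal idempotents as long as its annihilator contains an x with
    x^3 nonzero. When none is left, triple products vanish on the annihilator; as a - ea is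
    multiplicative in a and A is spanned by triple products, e is a unit. *)
Lemma unit_exists : exists u : A, forall a : A, u ** a = a.
Proof.
(* The free list s collects vectors fixed by e and can have at most 3 entries, so n bounds the
   remaining enlargements and n = 0 is impossible. *)
suff : forall n (s : seq A) (e : A), (n + size s = 4)%N -> free s -> e ** e = e ->
    (forall g, g \in s -> e ** g = g) -> exists u : A, forall a : A, u ** a = a.
  by move=> /(_ 4%N [::] 0); apply; rewrite ?nil_free ?amul0l.
elim=> [|n IHn] s e; first by rewrite add0n => s4 /size_free; rewrite s4.
move=> ns sfree ee es.
have [eunit|/existsNP[y /eqP ey]] := EM (forall a, e ** a = a); first by exists e.
have [[x [ex /eqP x3]]|nox] := EM (exists x, e ** x = 0 /\ x ** (x ** x) <> 0).
  have [//|[f [f0 ff fx]]] := idempotent_or_unit x3.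
  have ef := fx e ex.
  apply: (IHn (f :: s) (e + f)); first by rewrite /= addnS -addSn.
  - rewrite free_cons sfree andbT; apply/negP => fs.
    have eid : forall v, v \in <<s>>%VS -> e ** v = v.
      move=> v vs; rewrite (coord_span (X := in_tuple s) vs) amul_sumr.
      by apply: eq_bigr => i _; rewrite amulZr es // mem_nth.
    by move: f0; rewrite -(eid f fs) ef eqxx.
  - by rewrite amulDl !amulDr ee ff (mulC f) ef addr0 add0r.
  - move=> g; rewrite inE => /orP[/eqP->|gs]; rewrite amulDl.
      by rewrite ef ff add0r.
    by rewrite es // -{2}(es g gs) -mulA (mulC f) ef amul0l addr0.
case/negP: ey; apply/eqP; apply/eqP; rewrite eq_sym -subr_eq0; apply/eqP.
pose P (u : A) := e ** u = 0.
have Plin (k : K) (a b : A) : P a -> P b -> P (k *: a + b).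
  by rewrite /P amulDr amulZr => -> ->; rewrite scaler0 addr0.
have P3 (u v w : A) : P u -> P v -> P w -> u ** (v ** w) = 0.
  apply: cubes_zero => // t Pt; apply/eqP; apply/negPn/negP => /eqP t3.
  by apply: nox; exists t.
have Pproj (a : A) : P (a - e ** a).
  by rewrite /P amulDr -scaleN1r amulZr -mulA ee scaleN1r subrr.
have projM (a b : A) : (a - e ** a) ** (b - e ** b) = a ** b - e ** (a ** b).
  rewrite amulDl !amulDr -!scaleN1r !amulZl !amulZr.
  rewrite -[a ** (e ** b)]mulA (mulC a e) mulA -[(e ** a) ** (e ** b)]mulA.
  rewrite [(e ** a) ** e]mulC -[e ** (e ** a)]mulA ee mulA.
  by rewrite scalerA mulrNN mulr1 scale1r scaleN1r addNr addr0.
have proj3 (a b c : A) : a ** (b ** c) - e ** (a ** (b ** c)) = 0.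
  by rewrite -projM -projM P3.
(* A^2 = A writes one factor as a combination of products, which passes from triple to double
   products; the same argument then passes to single elements. *)
have proj2 : forall a b : A, a ** b - e ** (a ** b) = 0.
  move=> a; apply: mul_span => [k b c|b c]; last exact: proj3.
  rewrite !amulDr !amulZr => hb hc.
  by rewrite opprD addrACA hc addr0 -scalerBr hb scaler0.
move: y; apply: mul_span => [k b c hb hc|b c]; last exact: proj2.
by rewrite amulDr amulZr opprD addrACA hc addr0 -scalerBr hb scaler0.
Qed.

End AssociativeUnit.

                       

(** * The classification by the dimension of the square *)

Section Classification.
Variables (K : numClosedFieldType) (A : algebra K).
Hypothesis dimA : \dim (fullv : {vspace A}) = 3%N.
Hypothesis mulC : forall x y : A, x ** y = y ** x.

Lemma extend_free (s : seq A) : free s -> (size s < 3)%N ->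
  exists v, free (v :: s).
Proof.
move=> sfree s3; have : ~~ (fullv <= <<s>>)%VS.
  apply: contraL s3 => /dimvS; rewrite dimA -leqNgt => H.
  by apply: leq_trans H _; exact: dim_span.
by case/subvPn => v _ vs; exists v; rewrite free_cons vs.
Qed.

Lemma free3_comb (v1 v2 v3 : A) : free [:: v1; v2; v3] ->
  forall a, exists k1 k2 k3, a = comb v1 v2 v3 (vec k1 k2 k3).
Proof.
move=> vfree a; have [k1 [k2 [k3 ->]]] := free3_span dimA vfree a.
by exists k1, k2, k3; rewrite /comb !vec_coord.
Qed.

Lemma comb_inj (v1 v2 v3 : A) : free [:: v1; v2; v3] ->
  injective (comb v1 v2 v3).
Proof.
move=> vfree x y /eqP; rewrite -subr_eq0 -linearB => /eqP.
set z := x - y => z0; apply/eqP; rewrite -subr_eq0 -/z.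
have /freeP/(_ (fun i => z 0 i)) z_0 : free [tuple v1; v2; v3] by [].
apply/eqP/rowP => i; rewrite [RHS]mxE; apply: z_0.
rewrite -[RHS]z0 !big_ord_recl big_ord0 addr0 /= /comb -addrA.
by do !congr (_ + _); congr (_ *: _); congr (z _ _); apply/val_inj.
Qed.

Lemma comb1 (v1 v2 v3 : A) : comb v1 v2 v3 (vec 1 0 0) = v1.
Proof. by rewrite /comb !vec_coord scale1r !scale0r !addr0. Qed.
Lemma comb2 (v1 v2 v3 : A) : comb v1 v2 v3 (vec 0 1 0) = v2.
Proof. by rewrite /comb !vec_coord scale1r !scale0r add0r addr0. Qed.
Lemma comb3 (v1 v2 v3 : A) : comb v1 v2 v3 (vec 0 0 1) = v3.
Proof. by rewrite /comb !vec_coord scale1r !scale0r !add0r. Qed.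

Lemma comb_assoc (v1 v2 v3 : A) p11 p12 p13 p22 p23 p33 :
  free [:: v1; v2; v3] ->
  v1 ** v1 = comb v1 v2 v3 p11 -> v1 ** v2 = comb v1 v2 v3 p12 ->
  v1 ** v3 = comb v1 v2 v3 p13 -> v2 ** v2 = comb v1 v2 v3 p22 ->
  v2 ** v3 = comb v1 v2 v3 p23 -> v3 ** v3 = comb v1 v2 v3 p33 ->
  forall x y z : table p11 p12 p13 p22 p23 p33,
  (comb v1 v2 v3 x ** comb v1 v2 v3 y) ** comb v1 v2 v3 z =
    comb v1 v2 v3 x ** (comb v1 v2 v3 y ** comb v1 v2 v3 z) ->
  (x ** y) ** z = x ** (y ** z).
Proof.
move=> vfree e11 e12 e13 e22 e23 e33 x y z E.
apply: (comb_inj vfree).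
have M := comb_mul mulC e11 e12 e13 e22 e23 e33.
by rewrite (M (x ** y)) (M x y) (M x (y ** z)) (M y z).
Qed.

Lemma unital_alg_listed (e : A) :
  (forall x y z : A, (x ** y) ** z = x ** (y ** z)) ->
  (forall a, e ** a = a) -> listed A.
Proof.
move=> mulA eunit.
have e0 : e != 0.
  apply/eqP => e0; have : (fullv <= (0 : {vspace A}))%VS.
    by apply/subvP => a _; rewrite memv0 -(eunit a) e0 amul0l.
  by rewrite subv0 -dimv_eq0 dimA.
have [y yfree] := @extend_free [:: e] ltac:(by rewrite seq1_free) isT.
have [z zfree] := extend_free yfree isT.
have {zfree} ezfree : free [:: e; y; z].
  by rewrite -(perm_free (permEl (perm_rev [:: e; y; z]))).
have cE := free3_comb ezfree.
have [a1 [a2 [a3 yy]]] := cE (y ** y).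
have [b1 [b2 [b3 yz]]] := cE (y ** z).
have [c1 [c2 [c3 zz]]] := cE (z ** z).
have ee : e ** e = comb e y z (vec 1 0 0) by rewrite comb1.
have ey : e ** y = comb e y z (vec 0 1 0) by rewrite comb2.
have ez : e ** z = comb e y z (vec 0 0 1) by rewrite comb3.
apply: (listed_iso (iso_of_basis dimA mulC ezfree ee ey ez yy yz zz)).
have PA x1 x2 x3 : _ := comb_assoc ezfree ee ey ez yy yz zz (mulA _ _ _)
  (x := x1) (y := x2) (z := x3).
have := PA (vec 0 1 0) (vec 0 1 0) (vec 0 0 1).
have := PA (vec 0 1 0) (vec 0 0 1) (vec 0 0 1).
rewrite /= !table_mul_vec /= => /vec_inj[E1 E2 E3] /vec_inj[F1 F2 F3].
apply: unital_listed; move: E1 E2 E3 F1 F2 F3.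
rewrite !(mulr0, mul0r, mulr1, mul1r, addr0, add0r) => E1 E2 E3 F1 F2 F3.
clear -E1 E2 E3 F1 F2 F3.
by do !split; fnsatz.
Qed.

Lemma square_plane_listed (v1 v2 v3 : A) :
  free [:: v1; v2; v3] -> nontrivial A ->
  (forall x y : A, exists s t, x ** y = s *: v1 + t *: v2) ->
  (v1 ** v1) ** v2 = v1 ** (v1 ** v2) -> (v1 ** v2) ** v2 = v1 ** (v2 ** v2) ->
  listed A.
Proof.
move=> vfree nt prod A1 A2.
have prodE (x y : A) : exists s t, x ** y = comb v1 v2 v3 (vec s t 0).
  have [s [t ->]] := prod x y; exists s, t.
  by rewrite /comb !vec_coord scale0r addr0.
have [b1 [b2 e11]] := prodE v1 v1; have [c1 [c2 e12]] := prodE v1 v2.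
have [d1 [d2 e22]] := prodE v2 v2; have [a1 [a2 e13]] := prodE v1 v3.
have [p1 [p2 e23]] := prodE v2 v3; have [w1 [w2 e33]] := prodE v3 v3.
have iso := iso_of_basis dimA mulC vfree e11 e12 e13 e22 e23 e33.
apply: (listed_iso iso); apply: block_listed; last exact: (nontrivial_iso iso nt).
have PA := comb_assoc vfree e11 e12 e13 e22 e23 e33.
have := PA (vec 1 0 0) (vec 1 0 0) (vec 0 1 0).
have := PA (vec 1 0 0) (vec 0 1 0) (vec 0 1 0).
rewrite !comb1 !comb2 => /(_ A2) + /(_ A1).
rewrite /= !table_mul_vec /= => /vec_inj[E1 E2 _] /vec_inj[F1 F2 _].
move: E1 E2 F1 F2; rewrite !(mulr0, mul0r, mulr1, mul1r, addr0, add0r).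
move=> E1 E2 F1 F2; clear -E1 E2 F1 F2.
by split; fnsatz.
Qed.

Lemma square_line_listed (v1 : A) : v1 != 0 -> nontrivial A ->
  (forall x y : A, exists s, x ** y = s *: v1) -> listed A.
Proof.
move=> v0 nt prod.
have [y yfree] := @extend_free [:: v1] ltac:(by rewrite seq1_free) isT.
have [z zfree] := extend_free yfree isT.
have {zfree} vfree : free [:: v1; y; z].
  by rewrite -(perm_free (permEl (perm_rev [:: v1; y; z]))).
have prodE (u w : A) : exists s, u ** w = comb v1 y z (vec s 0 0).
  have [s ->] := prod u w; exists s.
  by rewrite /comb !vec_coord !scale0r !addr0.
have [f11 e11] := prodE v1 v1; have [f12 e12] := prodE v1 y.
have [f13 e13] := prodE v1 z; have [f22 e22] := prodE y y.
have [f23 e23] := prodE y z; have [f33 e33] := prodE z z.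
have iso := iso_of_basis dimA mulC vfree e11 e12 e13 e22 e23 e33.
by apply: (listed_iso iso); apply: ltab_listed; exact: (nontrivial_iso iso nt).
Qed.

(** [in_square] asks for a finite list depending on the vector; the products of basis vectors form
    one list that serves for all. *)
Lemma square_in_span : exists U : {vspace A},
  (forall x y : A, x ** y \in U) /\ (forall v, v \in U -> in_square v).
Proof.
pose X := vbasis (fullv : {vspace A}).
pose s := [seq (x, y) | x <- X, y <- X] : seq (A * A).
exists <<[seq p.1 ** p.2 | p <- s]>>%VS; split=> [x y|v vU]; last by exists s.
rewrite (coord_vbasis (memvf x)) (coord_vbasis (memvf y)).
rewrite (amul_sumr mulC) memv_suml // => j _.
rewrite mulC (amul_sumr mulC) memv_suml // => i _.
rewrite amulZl amulZr; apply/memvZ/memvZ/memv_span.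
apply/mapP; exists (X`_j, X`_i) => //.
by apply/allpairs_f; apply: mem_nth; rewrite size_tuple.
Qed.

(** The cases are the lengths 0, 1, 2 and at least 3 of a basis of the square; the first contradicts
    nontriviality and in the last the square is all of A. *)
Lemma derived_comm_assoc_listed :
  nontrivial A -> square_comm_assoc A -> listed A.
Proof.
move=> nt [_ sqA]; have [U [prodU Usq]] := square_in_span.
have Uspan : <<vbasis U>>%VS = U := span_basis (vbasisP U).
have Ufree : free (vbasis U) := basis_free (vbasisP U).
have memU v : v \in (vbasis U : seq A) -> v \in U by exact: vbasis_mem.
have dimU : size (vbasis U) = \dim U by rewrite size_tuple.
case: (tval (vbasis U)) Uspan Ufree memU dimU => [|v1 [|v2 [|v3 s]]] Uspan Ufree memU dimU.
- have [x [y]] := nt; have := prodU x y.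
  by rewrite -Uspan span_nil memv0 => ->.
- apply: (@square_line_listed v1) => //; first by rewrite -seq1_free.
  by move=> x y; have := prodU x y; rewrite -Uspan span_seq1 => /vlineP.
- have [v3] := extend_free Ufree isT.
  have -> : free [:: v3; v1; v2] = free [:: v1; v2; v3].
    by apply: perm_free; rewrite (perm_catC [:: v3] [:: v1; v2]).
  move=> vfree; apply: (square_plane_listed vfree) => //.
  + move=> x y; have := prodU x y; rewrite -Uspan span_cons span_seq1.
    by case/memv_addP => a /vlineP[s ->] [b /vlineP[t ->] ->]; exists s, t.
  + by apply: sqA; apply/Usq/memU; rewrite !inE eqxx ?orbT.
  + by apply: sqA; apply/Usq/memU; rewrite !inE eqxx ?orbT.
have UT : U = fullv.
  by apply/eqP; rewrite eqEdim subvf dimA -dimU.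
have mulA (x y z : A) : (x ** y) ** z = x ** (y ** z).
  by apply: sqA; apply: Usq; rewrite UT memvf.
suff [e eunit] : exists e : A, forall a, e ** a = a by exact: unital_alg_listed eunit.
apply: (unit_exists dimA mulC mulA) => P Plin Pprod a.
have [t at_] := Usq a ltac:(by rewrite UT memvf).
have P0 : P 0 by rewrite -(amul0l a).
rewrite (coord_span (X := in_tuple _) at_).
apply: (big_ind P) => // [u w Pu Pw|i _].
  by rewrite -[u]scale1r; exact: Plin.
rewrite -[_ *: _]addr0; apply: Plin => //.
have : (in_tuple [seq p.1 ** p.2 | p <- t])`_i \in [seq p.1 ** p.2 | p <- t].
  exact: mem_nth.
by case/mapP => p _ ->.
Qed.

End Classification.

Unset Implicit Arguments.

Theorem theoremA2 (R : realType) :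
  (forall A : algebra R[i],
     \dim (fullv : {vspace A}) = 3%N ->
     nontrivial A ->
     derived_comm_assoc A ->
     (exists l : M_label R[i], alg_isomorphic A (M_algebra l)) \/
     (exists l : J_label, alg_isomorphic A (J_algebra R[i] l)) \/
     (exists l : A_label R[i], alg_isomorphic A (A_algebra l)))
  /\
  (forall l l' : A_label R[i],
     alg_isomorphic (A_algebra l) (A_algebra l') <-> same_class l l').
Proof.
split=> [A dimA nt [mulC sqA]|l l']; last exact: A_algebra_iso.
exact: derived_comm_assoc_listed.
Qed.
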